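(* Let $T$ be a 2-monad on a 2-category $\mathcal{K}$ and suppose that (1) $\mathcal{K}$ admits pseudolimits of 1-cells; (2) $\mathcal{K}$ admits cotensors (a) of the form $\{\mathbf{2},C\}$ for $C\in\mathcal{K}$ and (b) of the form $\{\mathbb{I},C\}$ for $C\in\mathcal{K}$; (3) $T\text{-}\mathrm{Alg}_s$ admits pushouts; and (4) $T\text{-}\mathrm{Alg}_s$ admits coequalizers of $P$-free pairs (a condition that is meaningful, and imposed, whenever $T$ admits universal pseudomorphisms). Then the following two conditions are equivalent: (A) $T$ admits a pseudomorphism classifier $(Q,i,\zeta,\delta)$; (B) $T$ admits universal pseudomorphisms $\widetilde\phi$. Moreover, in this case, the following hold for each $T$-algebra $Y$ and each 1-cell $\phi\colon C\to C'$ in $\mathcal{K}$: (C) the components $\zeta_Y$ and $\delta_Y$ are part of an adjoint surjective equivalence (in $T\text{-}\mathrm{Alg}$); (D) the induced strict morphism of $T$-algebras $\Delta\colon T(C',\phi)\to TC'$ is a surjective equivalence in $T\text{-}\mathrm{Alg}_s$.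
   Context: Limits and colimits in 2-categories are in the $\mathrm{Cat}$-enriched sense. $\mathbf 2=\{0\to1\}$ is the free arrow category and $\mathbb{I}=\{0\cong1\}$ the free isomorphism category. The cotensor $\{E,X\}$ of a small category $E$ and $X\in\mathcal{K}$ is an object with a 2-natural isomorphism $\mathrm{Cat}(E,\mathcal{K}(-,X))\cong\mathcal{K}(-,\{E,X\})$. The pseudolimit of a 1-cell $f\colon A\to B$ is the 2-categorically universal $L$ with 1-cells $a\colon L\to A$, $b\colon L\to B$ and an invertible 2-cell $fa\cong b$. 2-monads. A 2-monad $(T,\mu,\eta)$ on $\mathcal{K}$ is a 2-functor with 2-natural $\mu\colon T^2\to T$, $\eta\colon1\to T$ satisfying the strict monad axioms. A $T$-algebra $(X,x)$ is an object $X$ and a 1-cell $x\colon TX\to X$ with $x\eta_X=1_X$, $x\mu_X=x\,Tx$. A $T$-map (pseudomorphism) $(f,f_\bullet)\colon(X,x)\to(Y,y)$ is a 1-cell $f$ with an invertible 2-cell $f_\bullet\colon y\circ Tf\Rightarrow f\circ x$ such that $f_\bullet*\eta_X=1_f$ and $(f_\bullet*Tx)\circ(y*Tf_\bullet)=f_\bullet*\mu_X$; it is strict if $f_\bullet$ is an identity. Composition: $(f'f)_\bullet=(f'*f_\bullet)\circ(f'_\bullet*Tf)$. A $T$-algebra 2-cell $\alpha\colon f\to g$ is a 2-cell with $(\alpha*x)\circ f_\bullet=g_\bullet\circ(y*T\alpha)$. These give 2-categories $T\text{-}\mathrm{Alg}$ (all $T$-maps) and $T\text{-}\mathrm{Alg}_s$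 (strict $T$-maps), the inclusion $i\colon T\text{-}\mathrm{Alg}_s\to T\text{-}\mathrm{Alg}$, and forgetful 2-functors $u$ to $\mathcal{K}$. The free algebra on $C$ is $TC=(TC,\mu_C)$. Arrow categories. $\mathcal{K}^{\mathbf 2}$ has objects the 1-cells $\phi\colon C\to C'$ and morphisms $(R,S)\colon\phi\to\psi$ the pairs with $\psi R=S\phi$. $T\text{-}\mathrm{Alg}^{\mathbf 2,s}$ has objects the $T$-maps and morphisms $(j,k)\colon f\to g$ the pairs of strict $T$-maps with $gj=kf$ in $T\text{-}\mathrm{Alg}$. There is an evident forgetful functor $u\colon T\text{-}\mathrm{Alg}^{\mathbf 2,s}\to\mathcal{K}^{\mathbf 2}$. Universal pseudomorphisms. $T$ admits universal pseudomorphisms if for each 1-cell $\phi\colon C\to C'$ there are a $T$-algebra $T(C',\phi)$, a $T$-map $\widetilde\phi\colon TC\to T(C',\phi)$, and a 1-cell $\kappa_\phi\colon C'\to uT(C',\phi)$ with $(\eta_C,\kappa_\phi)\colon\phi\to u\widetilde\phi$ a morphism of $\mathcal{K}^{\mathbf 2}$, such that for every $T$-map $f$ the function $T\text{-}\mathrm{Alg}^{\mathbf 2,s}(\widetilde\phi,f)\to\mathcal{K}^{\mathbf 2}(\phi,uf)$ given by $u$ followed by precomposition with $(\eta_C,\kappa_\phi)$ is a bijection. For $(R,S)\colon\phi\to uf$, write $(\overline R,\overline S)\colon\widetilde\phi\to f$ for the corresponding morphism. The map $\Delta=\overline{\eta_{C'}}\colon T(C',\phi)\to TC'$ is the strict $T$-map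 corresponding to $(\eta_C,\eta_{C'})\colon\phi\to u(T\phi)$. $P$-free pairs. When $T$ admits universal pseudomorphisms, set $PC=T(C,1_C)$ for $C\in\mathcal{K}$. For a $T$-map $f\colon TC\to TC'$, let $Pf\colon PC\to PC'$ be the unique strict $T$-map with $(1_{TC},Pf)\colon\widetilde{1_C}\to\widetilde{1_{C'}}\circ f$ in $T\text{-}\mathrm{Alg}^{\mathbf 2,s}$ corresponding to $(\eta_C,S)\colon1_C\to u(\widetilde{1_{C'}}\circ f)$, where $S=u\widetilde{1_{C'}}\circ uf\circ\eta_C$. The $P$-free pair of a $T$-algebra $(X,x)$ is the pair of strict $T$-maps $P\mu_X,\,P(Tx)\colon P(TX)\rightrightarrows PX$ (from $\mu_X,Tx\colon T^2X\rightrightarrows TX$). $T\text{-}\mathrm{Alg}_s$ admits coequalizers of $P$-free pairs if this pair has a coequalizer, in the underlying 1-category of $T\text{-}\mathrm{Alg}_s$, for each $T$-algebra $(X,x)$. Pseudomorphism classifier. A pseudomorphism classifier for $T$ is a left 2-adjoint $Q\colon T\text{-}\mathrm{Alg}\to T\text{-}\mathrm{Alg}_s$ of $i$, with unit components $T$-maps $\zeta_X\colon X\to iQX$ and counit components strict $T$-maps $\delta_Y\colon QiY\to Y$. Equivalences. For 1-cells $\zeta\colon Y\to Z$, $\delta\colon Z\to Y$ in a 2-category, $(\zeta,\delta)$ is a surjective equivalence (and $\delta$ is called a surjective equivalence) if $\delta\zeta=1_Y$ and there is an invertible 2-cell $\Theta\colon\zeta\delta\cong1_Z$; $(\zeta,\delta,\Theta)$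 is an adjoint surjective equivalence if moreover $\Theta*\zeta=1_\zeta$ (equivalently, $(\zeta,\delta,1_{1_Y},\Theta)$ is an internal adjoint equivalence). *)

(* Defs.v *)
From Stdlib Require Import ssreflect ssrbool ProofIrrelevance FunctionalExtensionality.

Set Implicit Arguments.
Unset Strict Implicit.
Unset Printing Implicit Defensive.

(* Categories are presented with a single type of arrows together with domain
   and codomain functions.  As a consequence, an equation between 2-cells of a
   2-category is a plain equality even when the boundaries of its two sides are
   only propositionally equal, and no transport is ever needed. *)
Record Category : Type := MkCategory {
  obj :> Type;
  arr : Type;
  dom : arr -> obj;
  cod : arr -> obj;
  idm : obj -> arr;
  cmp : forall g f : arr, cod f = dom g -> arr;
  dom_id : forall x, dom (idm x) = x;
  cod_id : forall x, cod (idm x) = x;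
  dom_cmp : forall g f e, dom (@cmp g f e) = dom f;
  cod_cmp : forall g f e, cod (@cmp g f e) = cod g;
  cmp_idl : forall f e, @cmp (idm (cod f)) f e = f;
  cmp_idr : forall f e, @cmp f (idm (dom f)) e = f;
  cmp_assoc : forall h g f e1 e2 e3 e4,
    @cmp h (@cmp g f e1) e2 = @cmp (@cmp h g e3) f e4 }.

Arguments dom {c} _.
Arguments cod {c} _.
Arguments idm {c} _.
Arguments cmp {c} g f _.

(* [Cmp b a c]: the arrows b and a are composable and their composite b a is c. *)
Definition Cmp (C : Category) (b a c : arr C) : Prop :=
  exists e : cod a = dom b, cmp b a e = c.

Definition invertible (C : Category) (a : arr C) : Prop :=
  exists b : arr C, Cmp b a (idm (dom a)) /\ Cmp a b (idm (cod a)).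

Record Functor (C D : Category) : Type := MkFunctor {
  fo :> C -> D;
  fa : arr C -> arr D;
  dom_fa : forall f, dom (fa f) = fo (dom f);
  cod_fa : forall f, cod (fa f) = fo (cod f);
  fa_id : forall x, fa (idm x) = idm (fo x);
  fa_cmp : forall g f c, Cmp g f c -> Cmp (fa g) (fa f) (fa c) }.

Definition is_cat_iso (C D : Category) (F : Functor C D) : Prop :=
  exists G : Functor D C,
    (forall x, G (F x) = x) /\ (forall y, F (G y) = y) /\
    (forall f, fa G (fa F f) = f) /\ (forall g, fa F (fa G g) = g).

Record TwoCat : Type := MkTwoCat {
  ob :> Type;
  hom : ob -> ob -> Category;
  one : forall A, hom A A;
  comp1 : forall A B C, hom B C -> hom A B -> hom A C;
  comp2 : forall A B C, arr (hom B C) -> arr (hom A B) -> arr (hom A C);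
  dom_comp2 : forall A B C b a, dom (@comp2 A B C b a) = comp1 (dom b) (dom a);
  cod_comp2 : forall A B C b a, cod (@comp2 A B C b a) = comp1 (cod b) (cod a);
  comp2_id : forall A B C (g : hom B C) (f : hom A B),
    comp2 (idm g) (idm f) = idm (comp1 g f);
  interchange : forall A B C (b' b b'' : arr (hom B C)) (a' a a'' : arr (hom A B)),
    Cmp b' b b'' -> Cmp a' a a'' -> Cmp (comp2 b' a') (comp2 b a) (comp2 b'' a'');
  comp1_1l : forall A B (f : hom A B), comp1 (one B) f = f;
  comp1_1r : forall A B (f : hom A B), comp1 f (one A) = f;
  comp1_assoc : forall A B C D (h : hom C D) (g : hom B C) (f : hom A B),
    comp1 h (comp1 g f) = comp1 (comp1 h g) f;
  comp2_1l : forall A B (a : arr (hom A B)), comp2 (idm (one B)) a = a;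
  comp2_1r : forall A B (a : arr (hom A B)), comp2 a (idm (one A)) = a;
  comp2_assoc : forall A B C D
      (c : arr (hom C D)) (b : arr (hom B C)) (a : arr (hom A B)),
    comp2 c (comp2 b a) = comp2 (comp2 c b) a }.

Arguments hom {t} A B.
Arguments one {t} A.
Arguments comp1 {t A B C} _ _.
Arguments comp2 {t A B C} _ _.

Notation cell A B := (arr (hom A B)).
Notation "g ∘ f" := (comp1 g f) (at level 40, left associativity).
Notation "b ⋆ a" := (comp2 b a) (at level 40, left associativity).
Notation "'\1' f" := (idm f) (at level 10, f at level 9, format "\1 f").

Record TwoFunctor (K L : TwoCat) : Type := MkTwoFunctor {
  tfo :> K -> L;
  tfh : forall A B : K, Functor (hom A B) (hom (tfo A) (tfo B));
  tf_one : forall A, tfh A A (one A) = one (tfo A);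
  tf_comp1 : forall A B C (g : hom B C) (f : hom A B),
    tfh A C (g ∘ f) = tfh B C g ∘ tfh A B f;
  tf_comp2 : forall A B C (b : cell B C) (a : cell A B),
    fa (tfh A C) (b ⋆ a) = fa (tfh B C) b ⋆ fa (tfh A B) a }.

Notation map1 F f := (fo (tfh F _ _) f).
Notation map2 F a := (fa (tfh F _ _) a).

Record TwoNat (K L : TwoCat) (F G : TwoFunctor K L) : Type := MkTwoNat {
  tn :> forall A : K, hom (F A) (G A);
  tn_nat1 : forall A B (f : hom A B), tn B ∘ map1 F f = map1 G f ∘ tn A;
  tn_nat2 : forall A B (a : cell A B), \1 (tn B) ⋆ map2 F a = map2 G a ⋆ \1 (tn A) }.

Section CmpTheory.
Variable C : Category.
Implicit Types a b c : arr C.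

Lemma CmpI b a (e : cod a = dom b) : Cmp b a (cmp b a e).
Proof. by exists e. Qed.

Lemma Cmp_fun b a c c' : Cmp b a c -> Cmp b a c' -> c = c'.
Proof. by move=> [e <-] [e' <-]; rewrite (proof_irrelevance _ e e'). Qed.

Lemma Cmp_ex b a : cod a = dom b -> exists c, Cmp b a c.
Proof. by move=> e; exists (cmp b a e); apply: CmpI. Qed.

Lemma Cmp_match b a c : Cmp b a c -> cod a = dom b.
Proof. by case. Qed.

Lemma Cmp_dom b a c : Cmp b a c -> dom c = dom a.
Proof. by move=> [e <-]; rewrite dom_cmp. Qed.

Lemma Cmp_cod b a c : Cmp b a c -> cod c = cod b.
Proof. by move=> [e <-]; rewrite cod_cmp. Qed.

Lemma Cmp_assocl a b c ba cba cb :
  Cmp b a ba -> Cmp c ba cba -> Cmp c b cb -> Cmp cb a cba.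
Proof.
move=> [e1 <-] [e2 <-] [e3 <-].
have e4 : cod a = dom (cmp c b e3) by rewrite dom_cmp.
by exists e4; rewrite -(cmp_assoc e2).
Qed.

Lemma Cmp_assocr a b c ba cba cb :
  Cmp c b cb -> Cmp cb a cba -> Cmp b a ba -> Cmp c ba cba.
Proof.
move=> [e1 <-] [e2 <-] [e3 <-].
have e4 : cod (cmp b a e3) = dom c by rewrite cod_cmp.
by exists e4; rewrite (cmp_assoc e4 e2).
Qed.

Lemma Cmp_idl a (x : C) : cod a = x -> Cmp (\1 x) a a.
Proof.
move=> <-; have e : cod a = dom (idm (cod a)) by rewrite dom_id.
by exists e; apply: cmp_idl.
Qed.

Lemma Cmp_idr a (x : C) : dom a = x -> Cmp a (\1 x) a.
Proof.
move=> <-; have e : cod (idm (dom a)) = dom a by rewrite cod_id.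
by exists e; apply: cmp_idr.
Qed.

Lemma invertible_id (x : C) : invertible (\1 x).
Proof.
by exists (idm x); rewrite dom_id cod_id; split; apply: Cmp_idl; rewrite cod_id.
Qed.

Lemma invertible_Cmp b a c :
  Cmp b a c -> invertible b -> invertible a -> invertible c.
Proof.
move=> Hba [b' [Hb Hb']] [a' [Ha Ha']].
have e := Cmp_match Hba.
have [c' Hc'] : exists c', Cmp a' b' c'.
  by apply: Cmp_ex; rewrite -(Cmp_cod Hb) cod_id -e (Cmp_match Ha).
exists c'; rewrite (Cmp_dom Hba) (Cmp_cod Hba).
split.
- have Hb'c : Cmp b' c a.
    by apply: Cmp_assocr Hb _ Hba; rewrite -e; apply: Cmp_idl.
  by apply: (Cmp_assocl Hb'c Ha Hc').
- have Hca' : Cmp c a' b.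
    by apply: Cmp_assocl Ha' _ Hba; rewrite e; apply: Cmp_idr.
  by apply: (Cmp_assocr Hca' Hb' Hc').
Qed.

End CmpTheory.

Record NatTrans (E C : Category) : Type := MkNatTrans {
  nsrc : Functor E C;
  ntgt : Functor E C;
  ncomp : E -> arr C;
  dom_ncomp : forall x, dom (ncomp x) = nsrc x;
  cod_ncomp : forall x, cod (ncomp x) = ntgt x;
  ncomp_nat : forall f : arr E, exists c,
    Cmp (fa ntgt f) (ncomp (dom f)) c /\ Cmp (ncomp (cod f)) (fa nsrc f) c }.

Lemma NatTrans_eq (E C : Category) (n m : NatTrans E C) :
  nsrc n = nsrc m -> ntgt n = ntgt m -> (forall x, ncomp n x = ncomp m x) -> n = m.
Proof.
case: n => F G n p q r; case: m => F' G' m p' q' r' /= eF eG enm.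
subst F' G'; have e : n = m by apply: functional_extensionality.
by subst m; f_equal; apply: proof_irrelevance.
Qed.

Definition nat_id (E C : Category) (F : Functor E C) : NatTrans E C.
Proof.
refine (@MkNatTrans E C F F (fun x => \1 (F x)) _ _ _).
- by move=> x; rewrite dom_id.
- by move=> x; rewrite cod_id.
- move=> f; exists (fa F f); split.
  + by apply: Cmp_idr; rewrite dom_fa.
  + by apply: Cmp_idl; rewrite cod_fa.
Defined.

Lemma nat_match (E C : Category) (m n : NatTrans E C) (e : ntgt n = nsrc m) x :
  cod (ncomp n x) = dom (ncomp m x).
Proof. by rewrite cod_ncomp dom_ncomp e. Qed.

Definition nat_cmp (E C : Category) (m n : NatTrans E C) (e : ntgt n = nsrc m) :
  NatTrans E C.
Proof.
refine (@MkNatTrans E C (nsrc n) (ntgt m)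
          (fun x => cmp (ncomp m x) (ncomp n x) (nat_match e x)) _ _ _).
- by move=> x; rewrite dom_cmp dom_ncomp.
- by move=> x; rewrite cod_cmp cod_ncomp.
- move=> f.
  have [c [Hc1 Hc2]] := ncomp_nat n f; have [d [Hd1 Hd2]] := ncomp_nat m f.
  rewrite -e in Hd2.
  have [u Hu] : exists u, Cmp d (ncomp n (dom f)) u.
    by apply: Cmp_ex; rewrite (Cmp_dom Hd1); apply: nat_match.
  exists u; split.
  + by apply: Cmp_assocr Hd1 Hu (CmpI _).
  + apply: (Cmp_assocl Hc2 _ (CmpI _)).
    by apply: Cmp_assocr Hd2 Hu Hc1.
Defined.

Definition FunCat (E C : Category) : Category.
Proof.
refine (@MkCategory (Functor E C) (NatTrans E C) (@nsrc E C) (@ntgt E C)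
          (@nat_id E C) (@nat_cmp E C) _ _ _ _ _ _ _) => //.
- move=> n e; apply: NatTrans_eq => //= x.
  apply: Cmp_fun (CmpI _) _; apply: Cmp_idl; exact: cod_ncomp.
- move=> n e; apply: NatTrans_eq => //= x.
  apply: Cmp_fun (CmpI _) _; apply: Cmp_idr; exact: dom_ncomp.
- move=> h g f e1 e2 e3 e4; apply: NatTrans_eq => //= x.
  apply: Cmp_fun (CmpI _) _.
  exact: Cmp_assocr (CmpI _) (CmpI _) (CmpI _).
Defined.

Definition thin_cat (O : Type) (R : O -> O -> Prop) (Rr : forall x, R x x)
  (Rt : forall x y z, R x y -> R y z -> R x z) : Category.
Proof.
refine (@MkCategory O {p : O * O | R (fst p) (snd p)}
  (fun a => fst (proj1_sig a)) (fun a => snd (proj1_sig a))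
  (fun x => exist (fun p => R (fst p) (snd p)) (x, x) (Rr x))
  (fun g f e => exist (fun p => R (fst p) (snd p))
     (fst (proj1_sig f), snd (proj1_sig g))
     (Rt _ _ _ (proj2_sig f)
        (eq_ind_r (fun y => R y (snd (proj1_sig g))) (proj2_sig g) e)))
  _ _ _ _ _ _ _) => //=.
- by move=> [[x y] r] e; apply: subset_eq_compat.
- by move=> [[x y] r] e; apply: subset_eq_compat.
- by move=> h g f *; apply: subset_eq_compat.
Defined.

(* The free arrow 0 -> 1, with 0 = false and 1 = true. *)
Definition arrow_cat : Category.
Proof.
refine (@thin_cat bool (fun x y => x = true -> y = true) _ _); auto.
Defined.

Definition iso_cat : Category.
Proof. by refine (@thin_cat bool (fun _ _ => True) _ _). Defined.

(* For h : A' -> A, the functor K(h,X) : K(A,X) -> K(A',X). *)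
Definition precomp (K : TwoCat) (A' A X : K) (h : hom A' A) :
  Functor (hom A X) (hom A' X).
Proof.
refine (@MkFunctor (hom A X) (hom A' X) (fun g => g ∘ h) (fun b => b ⋆ \1 h) _ _ _ _).
- by move=> b; rewrite dom_comp2 dom_id.
- by move=> b; rewrite cod_comp2 cod_id.
- by move=> g; rewrite comp2_id.
- move=> b a c H; apply: interchange => //.
  by apply: Cmp_idl; rewrite cod_id.
Defined.

Definition compF (C D E : Category) (G : Functor D E) (F : Functor C D) : Functor C E.
Proof.
refine (@MkFunctor C E (fun x => G (F x)) (fun f => fa G (fa F f)) _ _ _ _).
- by move=> f; rewrite !dom_fa.
- by move=> f; rewrite !cod_fa.
- by move=> x; rewrite !fa_id.
- by move=> g f c H; do 2 apply: fa_cmp.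
Defined.

(* For n : F => G : E -> K(A,X) and a 2-cell a : h => k : A' -> A, the horizontal
   composite K(a,X) * n : K(h,X) F => K(k,X) G. *)
Definition nat_hcomp (K : TwoCat) (E : Category) (A' A X : K)
  (n : NatTrans E (hom A X)) (a : cell A' A) : NatTrans E (hom A' X).
Proof.
refine (@MkNatTrans E (hom A' X)
  (compF (precomp X (dom a)) (nsrc n)) (compF (precomp X (cod a)) (ntgt n))
  (fun x => ncomp n x ⋆ a) _ _ _).
- by move=> x; rewrite dom_comp2 dom_ncomp.
- by move=> x; rewrite cod_comp2 cod_ncomp.
- move=> f; have [c [H1 H2]] := ncomp_nat n f.
  exists (c ⋆ a); split; apply: interchange => //.
  + by apply: Cmp_idl.
  + by apply: Cmp_idr.
Defined.

(* L is a cotensor {E,X}: an isomorphism Cat(E,K(-,X)) = K(-,L), 2-natural in the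
   argument (naturality at 1-cells for objects, at 2-cells for arrows; naturality
   at 1-cells for arrows is the case where the 2-cell is an identity). *)
Record is_cotensor (K : TwoCat) (E : Category) (X L : K) : Type := MkCotensor {
  cot :> forall A : K, Functor (FunCat E (hom A X)) (hom A L);
  cot_iso : forall A, is_cat_iso (cot A);
  cot_nat1 : forall (A' A : K) (h : hom A' A) (F : Functor E (hom A X)),
    cot A' (compF (precomp X h) F) = cot A F ∘ h;
  cot_nat2 : forall (A' A : K) (n : NatTrans E (hom A X)) (a : cell A' A),
    fa (cot A') (nat_hcomp n a : arr (FunCat E (hom A' X))) =
    fa (cot A) (n : arr (FunCat E (hom A X))) ⋆ a }.

Definition admits_cotensors (K : TwoCat) (E : Category) : Prop :=
  forall X : K, exists L : K, inhabited (is_cotensor E X L).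

Definition is_pseudolimit (K : TwoCat) (A B : K) (f : hom A B)
    (L : K) (a : hom L A) (b : hom L B) (l : cell L B) : Prop :=
  (dom l = f ∘ a /\ cod l = b /\ invertible l) /\
  (forall (X : K) (a' : hom X A) (b' : hom X B) (l' : cell X B),
     dom l' = f ∘ a' -> cod l' = b' -> invertible l' ->
     exists! h : hom X L, a ∘ h = a' /\ b ∘ h = b' /\ l ⋆ \1 h = l') /\
  (forall (X : K) (h h' : hom X L) (p : cell X A) (q : cell X B),
     dom p = a ∘ h -> cod p = a ∘ h' -> dom q = b ∘ h -> cod q = b ∘ h' ->
     (exists c, Cmp (l ⋆ \1 h') (\1 f ⋆ p) c /\ Cmp q (l ⋆ \1 h) c) ->
     exists! r : cell X L, dom r = h /\ cod r = h' /\ \1 a ⋆ r = p /\ \1 b ⋆ r = q).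

Definition admits_pseudolimits_of_1cells (K : TwoCat) : Prop :=
  forall (A B : K) (f : hom A B), exists (L : K) (a : hom L A) (b : hom L B)
    (l : cell L B), is_pseudolimit f a b l.

(* Cat-enriched pushout: K(P,X) is isomorphic to the pullback of K(B,X) and
   K(C,X) over K(A,X), both on objects and on arrows. *)
Definition is_pushout (K : TwoCat) (A B C : K) (f : hom A B) (g : hom A C)
    (P : K) (p : hom B P) (q : hom C P) : Prop :=
  p ∘ f = q ∘ g /\
  (forall (X : K) (u : hom B X) (v : hom C X), u ∘ f = v ∘ g ->
     exists! w : hom P X, w ∘ p = u /\ w ∘ q = v) /\
  (forall (X : K) (a : cell B X) (b : cell C X), a ⋆ \1 f = b ⋆ \1 g ->
     exists! c : cell P X, c ⋆ \1 p = a /\ c ⋆ \1 q = b).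

Definition admits_pushouts (K : TwoCat) : Prop :=
  forall (A B C : K) (f : hom A B) (g : hom A C),
    exists (P : K) (p : hom B P) (q : hom C P), is_pushout f g p q.

(* Coequalizer in the underlying 1-category. *)
Definition is_coequalizer1 (K : TwoCat) (A B : K) (f g : hom A B)
    (Z : K) (q : hom B Z) : Prop :=
  q ∘ f = q ∘ g /\
  (forall (X : K) (r : hom B X), r ∘ f = r ∘ g -> exists! w : hom Z X, w ∘ q = r).

Definition is_surj_equiv (K : TwoCat) (Y Z : K) (z : hom Y Z) (d : hom Z Y)
    (Th : cell Z Z) : Prop :=
  d ∘ z = one Y /\ dom Th = z ∘ d /\ cod Th = one Z /\ invertible Th.

Definition surjective_equivalence (K : TwoCat) (Y Z : K) (d : hom Z Y) : Prop :=
  exists (z : hom Y Z) (Th : cell Z Z), is_surj_equiv z d Th.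

Definition is_adj_surj_equiv (K : TwoCat) (Y Z : K) (z : hom Y Z) (d : hom Z Y)
    (Th : cell Z Z) : Prop :=
  is_surj_equiv z d Th /\ Th ⋆ \1 z = \1 z.

Definition idF (C : Category) : Functor C C.
Proof. by refine (@MkFunctor C C (fun x => x) (fun f => f) _ _ _ _). Defined.

Definition id2F (K : TwoCat) : TwoFunctor K K.
Proof. by refine (@MkTwoFunctor K K (fun A => A) (fun A B => idF (hom A B)) _ _ _). Defined.

Definition comp2F (K L M : TwoCat) (G : TwoFunctor L M) (F : TwoFunctor K L) :
  TwoFunctor K M.
Proof.
refine (@MkTwoFunctor K M (fun A => G (F A))
          (fun A B => compF (tfh G (F A) (F B)) (tfh F A B)) _ _ _) => /=.
- by move=> A; rewrite !tf_one.
- by move=> A B C g f; rewrite !tf_comp1.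
- by move=> A B C b a; rewrite !tf_comp2.
Defined.

(* F is left 2-adjoint to G. *)
Record TwoAdj (K L : TwoCat) (F : TwoFunctor K L) (G : TwoFunctor L K) : Type :=
  MkTwoAdj {
    adj_unit : TwoNat (id2F K) (comp2F G F);
    adj_counit : TwoNat (comp2F F G) (id2F L);
    adj_triangle1 : forall X : K, adj_counit (F X) ∘ map1 F (adj_unit X) = one (F X);
    adj_triangle2 : forall Y : L, map1 G (adj_counit Y) ∘ adj_unit (G Y) = one (G Y) }.

(* The locally full sub-2-category on a class of 1-cells. *)
Section LocallyFull.
Variables (K : TwoCat) (P : forall A B : K, hom A B -> Prop).
Hypothesis P_one : forall A, P (one A).
Hypothesis P_comp : forall A B C (g : hom B C) (f : hom A B), P g -> P f -> P (g ∘ f).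

Let Q A B (a : cell A B) : Prop := P (dom a) /\ P (cod a).

Lemma lf_id A B (f : hom A B) : P f -> Q (\1 f).
Proof. by rewrite /Q dom_id cod_id. Qed.

Lemma lf_cmp A B (b a : cell A B) e : Q b -> Q a -> Q (cmp b a e).
Proof. by rewrite /Q dom_cmp cod_cmp => -[_ ?] [? _]. Qed.

Lemma lf_comp2 A B C (b : cell B C) (a : cell A B) : Q b -> Q a -> Q (b ⋆ a).
Proof. by rewrite /Q dom_comp2 cod_comp2 => -[? ?] [? ?]; split; apply: P_comp. Qed.

Definition lf_hom (A B : K) : Category.
Proof.
refine (@MkCategory {f : hom A B | P f} {a : cell A B | P (dom a) /\ P (cod a)}
  (fun a => exist _ (dom (proj1_sig a)) (proj1 (proj2_sig a)))
  (fun a => exist _ (cod (proj1_sig a)) (proj2 (proj2_sig a)))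
  (fun f => exist _ (\1 (proj1_sig f)) (lf_id (proj2_sig f)))
  (fun b a e => exist _ (cmp (proj1_sig b) (proj1_sig a) (f_equal (@proj1_sig _ _) e))
                  (lf_cmp _ (proj2_sig b) (proj2_sig a)))
  _ _ _ _ _ _ _).
- by move=> [f p]; apply: subset_eq_compat => /=; rewrite dom_id.
- by move=> [f p]; apply: subset_eq_compat => /=; rewrite cod_id.
- by move=> b a e; apply: subset_eq_compat => /=; rewrite dom_cmp.
- by move=> b a e; apply: subset_eq_compat => /=; rewrite cod_cmp.
- by move=> [a p] e; apply: subset_eq_compat => /=; apply: cmp_idl.
- by move=> [a p] e; apply: subset_eq_compat => /=; apply: cmp_idr.
- by move=> c b a *; apply: subset_eq_compat => /=; apply: cmp_assoc.
Defined.

Lemma lf_Cmp A B (b a c : arr (lf_hom A B)) :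
  Cmp b a c <-> Cmp (proj1_sig b) (proj1_sig a) (proj1_sig c).
Proof.
split=> [[e <-]|[e H]]; first exact: CmpI.
have e' : cod a = dom b by apply: subset_eq_compat.
exists e'; case: c H => c p H; apply: subset_eq_compat.
exact: Cmp_fun (CmpI _) (ex_intro _ e H).
Qed.

Definition locally_full : TwoCat.
Proof.
refine (@MkTwoCat K lf_hom (fun A => exist _ (one A) (P_one A))
  (fun A B C g f => exist _ (proj1_sig g ∘ proj1_sig f)
                      (P_comp (proj2_sig g) (proj2_sig f)))
  (fun A B C b a => exist _ (proj1_sig b ⋆ proj1_sig a)
                      (lf_comp2 (proj2_sig b) (proj2_sig a)))
  _ _ _ _ _ _ _ _ _ _).
- by move=> A B C b a; apply: subset_eq_compat => /=; rewrite dom_comp2.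
- by move=> A B C b a; apply: subset_eq_compat => /=; rewrite cod_comp2.
- by move=> A B C g f; apply: subset_eq_compat => /=; rewrite comp2_id.
- by move=> A B C b' b b'' a' a a'' /lf_Cmp H /lf_Cmp H'; apply/lf_Cmp; apply: interchange.
- by move=> A B [f p]; apply: subset_eq_compat; apply: comp1_1l.
- by move=> A B [f p]; apply: subset_eq_compat; apply: comp1_1r.
- by move=> A B C D h g f; apply: subset_eq_compat; apply: comp1_assoc.
- by move=> A B [f p]; apply: subset_eq_compat; apply: comp2_1l.
- by move=> A B [f p]; apply: subset_eq_compat; apply: comp2_1r.
- by move=> A B C D h g f; apply: subset_eq_compat; apply: comp2_assoc.
Defined.

Definition lf_incl_hom A B : Functor (lf_hom A B) (hom A B).
Proof.
refine (@MkFunctor (lf_hom A B) (hom A B) (@proj1_sig _ _) (@proj1_sig _ _) _ _ _ _) => //.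
by move=> b a c /lf_Cmp.
Defined.

Definition lf_incl : TwoFunctor locally_full K.
Proof. by refine (@MkTwoFunctor locally_full K (fun A => A) lf_incl_hom _ _ _). Defined.

End LocallyFull.

Record TwoMonad (K : TwoCat) : Type := MkTwoMonad {
  tm :> TwoFunctor K K;
  mu : TwoNat (comp2F tm tm) tm;
  eta : TwoNat (id2F K) tm;
  mu_assoc : forall C : K, mu C ∘ map1 tm (mu C) = mu C ∘ mu (tm C);
  mu_etal : forall C : K, mu C ∘ map1 tm (eta C) = one (tm C);
  mu_etar : forall C : K, mu C ∘ eta (tm C) = one (tm C) }.

Section Algebras.
Variables (K : TwoCat) (T : TwoMonad K).

Record TAlg : Type := MkTAlg {
  ca :> K;
  act : hom (T ca) ca;
  act_unit : act ∘ eta T ca = one ca;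
  act_mult : act ∘ mu T ca = act ∘ map1 T act }.

(* [um2 f] is the 2-cell f_bullet : y o Tf => f o x. *)
Record TMap (X Y : TAlg) : Type := MkTMap {
  um :> hom X Y;
  um2 : cell (T X) Y;
  um2_dom : dom um2 = act Y ∘ map1 T um;
  um2_cod : cod um2 = um ∘ act X;
  um2_inv : invertible um2;
  um2_unit : um2 ⋆ \1 (eta T X) = \1 um;
  um2_mult : Cmp (um2 ⋆ \1 (map1 T (act X))) (\1 (act Y) ⋆ map2 T um2)
                 (um2 ⋆ \1 (mu T X)) }.

Lemma TMap_eq (X Y : TAlg) (f g : TMap X Y) : um f = um g -> um2 f = um2 g -> f = g.
Proof.
case: f => f f2 a b c d e; case: g => g g2 a' b' c' d' e' /= e1 e2.
by subst g g2; f_equal; apply: proof_irrelevance.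
Qed.

Definition is_strict (X Y : TAlg) (f : TMap X Y) : Prop :=
  um2 f = \1 (act Y ∘ map1 T f).

Definition strict_map (X Y : TAlg) (f : hom X Y)
  (H : act Y ∘ map1 T f = f ∘ act X) : TMap X Y.
Proof.
refine (@MkTMap X Y f (\1 (act Y ∘ map1 T f)) _ _ _ _ _).
- by rewrite dom_id.
- by rewrite cod_id.
- exact: invertible_id.
- by rewrite comp2_id H -comp1_assoc act_unit comp1_1r.
- rewrite fa_id !comp2_id.
  have -> : act Y ∘ map1 T (act Y ∘ map1 T f) = act Y ∘ map1 T f ∘ map1 T (act X).
    by rewrite -comp1_assoc -tf_comp1 H.
  have -> : act Y ∘ map1 T f ∘ mu T X = act Y ∘ map1 T f ∘ map1 T (act X).
    by rewrite H -!comp1_assoc act_mult.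
  by apply: Cmp_idl; rewrite cod_id.
Defined.

Lemma strict_map_strict (X Y : TAlg) (f : hom X Y)
  (H : act Y ∘ map1 T f = f ∘ act X) : is_strict (strict_map H).
Proof. by []. Qed.

Lemma is_strictP (X Y : TAlg) (f : TMap X Y) :
  is_strict f -> act Y ∘ map1 T f = f ∘ act X.
Proof. by move=> H; rewrite -um2_cod H cod_id. Qed.

Lemma one_strict (X : TAlg) : act X ∘ map1 T (one X) = one X ∘ act X.
Proof. by rewrite tf_one comp1_1r comp1_1l. Qed.

Definition TMap_one (X : TAlg) : TMap X X := strict_map (one_strict X).

Section Composition.
Variables (X Y Z : TAlg) (g : TMap Y Z) (f : TMap X Y).

Lemma TMap_comp_match :
  cod (um2 g ⋆ \1 (map1 T f)) = dom (\1 (um g) ⋆ um2 f).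
Proof. by rewrite cod_comp2 dom_comp2 um2_cod um2_dom cod_id dom_id comp1_assoc. Qed.

Definition TMap_comp2 : cell (T X) Z :=
  cmp (\1 (um g) ⋆ um2 f) (um2 g ⋆ \1 (map1 T f)) TMap_comp_match.

Lemma Cmp_wl (A B C : K) (h : hom B C) (b a c : cell A B) :
  Cmp b a c -> Cmp (\1 h ⋆ b) (\1 h ⋆ a) (\1 h ⋆ c).
Proof. by move=> H; apply: interchange H; apply: Cmp_idl; rewrite cod_id. Qed.

Lemma Cmp_wr (A B C : K) (h : hom A B) (b a c : cell B C) :
  Cmp b a c -> Cmp (b ⋆ \1 h) (a ⋆ \1 h) (c ⋆ \1 h).
Proof. by move=> H; apply: interchange H _; apply: Cmp_idl; rewrite cod_id. Qed.

Lemma Cmp_exl (A B C : K) (b : cell B C) (a : cell A B) (y : hom A B) (x : hom B C) :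
  cod a = y -> dom b = x -> Cmp (b ⋆ \1 y) (\1 x ⋆ a) (b ⋆ a).
Proof. by move=> e1 e2; apply: interchange; [apply: Cmp_idr | apply: Cmp_idl]. Qed.

Lemma Cmp_exr (A B C : K) (b : cell B C) (a : cell A B) (y : hom A B) (x : hom B C) :
  dom a = y -> cod b = x -> Cmp (\1 x ⋆ a) (b ⋆ \1 y) (b ⋆ a).
Proof. by move=> e1 e2; apply: interchange; [apply: Cmp_idl | apply: Cmp_idr]. Qed.

Lemma invertible_comp2 (A B C : K) (b : cell B C) (a : cell A B) :
  invertible b -> invertible a -> invertible (b ⋆ a).
Proof.
move=> [b' [H1 H2]] [a' [H3 H4]]; exists (b' ⋆ a').
by rewrite dom_comp2 cod_comp2 -!comp2_id; split; apply: interchange.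
Qed.

Definition TMap_comp : TMap X Z.
Proof.
pose p := TMap_comp2.
refine (@MkTMap X Z (um g ∘ um f) p _ _ _ _ _).
- by rewrite /p /TMap_comp2 dom_cmp dom_comp2 um2_dom dom_id tf_comp1 comp1_assoc.
- by rewrite /p /TMap_comp2 cod_cmp cod_comp2 um2_cod cod_id comp1_assoc.
- apply: invertible_Cmp (CmpI _) _ _.
  + exact: invertible_comp2 (invertible_id _) (um2_inv f).
  + exact: invertible_comp2 (um2_inv g) (invertible_id _).
- have e : um2 g ⋆ \1 (map1 T f) ⋆ \1 (eta T X) = \1 (um g ∘ um f).
    have := tn_nat1 (eta T) f; rewrite /= => H.
    by rewrite -comp2_assoc comp2_id -H -(comp2_id (eta T Y)) comp2_assoc um2_unit comp2_id.
  have H := Cmp_wr (eta T X) (CmpI TMap_comp_match : Cmp _ _ p).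
  apply: (Cmp_fun H); rewrite e -comp2_assoc um2_unit comp2_id.
  by apply: Cmp_idl; rewrite cod_id.
- have Hp : Cmp (\1 (um g) ⋆ um2 f) (um2 g ⋆ \1 (map1 T f)) p := CmpI _.
  have HpT := fa_cmp (tfh T _ _) Hp.
  rewrite !tf_comp2 !fa_id in HpT.
  have H1 := Cmp_wl (act Z) HpT.
  have H2 := Cmp_wr (map1 T (act X)) Hp.
  have H3 := Cmp_wr (mu T X) Hp.
  have Hf := Cmp_wl (um g) (um2_mult f).
  have Hg := Cmp_wr (map1 T (map1 T f)) (um2_mult g).
  have eG : um2 g ⋆ \1 (mu T Y) ⋆ \1 (map1 T (map1 T f)) =
            um2 g ⋆ \1 (map1 T f) ⋆ \1 (mu T X).
    by have := tn_nat1 (mu T) f; rewrite /= -!comp2_assoc !comp2_id => ->.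
  rewrite {}eG in Hg.
  have Hm1 : Cmp (um2 g ⋆ \1 (map1 T f) ⋆ \1 (map1 T (act X)))
                 (\1 (act Z) ⋆ \1 (map1 T g) ⋆ map2 T (um2 f))
                 (um2 g ⋆ map2 T (um2 f)).
    rewrite -comp2_assoc !comp2_id -tf_comp1.
    by apply: Cmp_exl; rewrite ?cod_fa ?um2_cod ?um2_dom.
  have Hm2 : Cmp (\1 (um g) ⋆ \1 (act Y) ⋆ map2 T (um2 f))
                 (um2 g ⋆ \1 (map1 T (act Y)) ⋆ \1 (map1 T (map1 T f)))
                 (um2 g ⋆ map2 T (um2 f)).
    rewrite -(comp2_assoc (um2 g)) !comp2_id -tf_comp1.
    by apply: Cmp_exr; rewrite ?dom_fa ?um2_cod ?um2_dom.
  rewrite !comp2_assoc in H1 H2 H3 Hf Hg.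
  have [s Hs] : exists s, Cmp (\1 (um g) ⋆ \1 (act Y) ⋆ map2 T (um2 f))
                             (um2 g ⋆ \1 (map1 T f) ⋆ \1 (mu T X)) s.
    by apply: Cmp_ex; rewrite (Cmp_match H3) (Cmp_dom Hf).
  apply: (Cmp_assocl _ (Cmp_assocr Hf H3 Hs) H2).
  exact: (Cmp_assocr Hm1 (Cmp_assocl Hg Hs Hm2) H1).
Defined.
End Composition.

Lemma um2_comp (X Y Z : TAlg) (g : TMap Y Z) (f : TMap X Y) :
  Cmp (\1 (um g) ⋆ um2 f) (um2 g ⋆ \1 (map1 T f)) (um2 (TMap_comp g f)).
Proof. exact: CmpI. Qed.

Record AlgCell (X Y : TAlg) : Type := MkAlgCell {
  adom : TMap X Y;
  acod : TMap X Y;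
  ucell : cell X Y;
  ucell_dom : dom ucell = um adom;
  ucell_cod : cod ucell = um acod;
  ucell_eq : exists c : cell (T X) Y,
    Cmp (ucell ⋆ \1 (act X)) (um2 adom) c /\
    Cmp (um2 acod) (\1 (act Y) ⋆ map2 T ucell) c }.

Lemma AlgCell_eq (X Y : TAlg) (a b : AlgCell X Y) :
  adom a = adom b -> acod a = acod b -> ucell a = ucell b -> a = b.
Proof.
case: a => d c u p q r; case: b => d' c' u' p' q' r' /= e1 e2 e3.
by subst d' c' u'; f_equal; apply: proof_irrelevance.
Qed.

Definition AlgCell_id (X Y : TAlg) (f : TMap X Y) : AlgCell X Y.
Proof.
refine (@MkAlgCell X Y f f (\1 (um f)) _ _ _).
- by rewrite dom_id.
- by rewrite cod_id.
- exists (um2 f); rewrite fa_id !comp2_id; split.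
  + by apply: Cmp_idl; apply: um2_cod.
  + by apply: Cmp_idr; apply: um2_dom.
Defined.

Lemma AlgCell_match (X Y : TAlg) (b a : AlgCell X Y) :
  acod a = adom b -> cod (ucell a) = dom (ucell b).
Proof. by rewrite ucell_cod ucell_dom => ->. Qed.

Definition AlgCell_cmp (X Y : TAlg) (b a : AlgCell X Y) (e : acod a = adom b) :
  AlgCell X Y.
Proof.
refine (@MkAlgCell X Y (adom a) (acod b)
          (cmp (ucell b) (ucell a) (AlgCell_match e)) _ _ _).
- by rewrite dom_cmp ucell_dom.
- by rewrite cod_cmp ucell_cod.
- have [c [Hc1 Hc2]] := ucell_eq a; have [d [Hd1 Hd2]] := ucell_eq b.
  rewrite -e in Hd1.
  have H : Cmp (ucell b) (ucell a) _ := CmpI (AlgCell_match e).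
  have H1 := Cmp_wr (act X) H.
  have H2 := Cmp_wl (act Y) (fa_cmp (tfh T _ _) H).
  have [s Hs] : exists s, Cmp (ucell b ⋆ \1 (act X)) c s.
    by apply: Cmp_ex; rewrite (Cmp_cod Hc1) (Cmp_match H1).
  exists s; split; first exact: Cmp_assocl Hc1 Hs H1.
  apply: (Cmp_assocr Hd2 _ H2).
  exact: Cmp_assocl Hc2 Hs Hd1.
Defined.

Lemma AlgCell_comp2_eq (X Y Z : TAlg) (b : AlgCell Y Z) (a : AlgCell X Y) :
  exists c : cell (T X) Z,
    Cmp (ucell b ⋆ ucell a ⋆ \1 (act X)) (um2 (TMap_comp (adom b) (adom a))) c /\
    Cmp (um2 (TMap_comp (acod b) (acod a))) (\1 (act Z) ⋆ map2 T (ucell b ⋆ ucell a)) c.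
Proof.
have [c [Hc1 Hc2]] := ucell_eq a; have [d [Hd1 Hd2]] := ucell_eq b.
have A1 := interchange (Cmp_idr (ucell_dom b)) Hc1.
have A2 := interchange (Cmp_idl (ucell_cod b)) Hc2.
have eT : dom (map2 T (ucell a)) = map1 T (adom a) by rewrite dom_fa ucell_dom.
have eT' : cod (map2 T (ucell a)) = map1 T (acod a) by rewrite cod_fa ucell_cod.
have B1 := interchange Hd1 (Cmp_idr eT).
have B2 := interchange Hd2 (Cmp_idl eT').
have Hp := CmpI (TMap_comp_match (adom b) (adom a)).
have Hp' := CmpI (TMap_comp_match (acod b) (acod a)).
rewrite !comp2_assoc in A1 A2 B1 B2.
have [s Hs] : exists s, Cmp (ucell b ⋆ c) (um2 (adom b) ⋆ \1 (map1 T (adom a))) s.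
  by apply: Cmp_ex; rewrite (Cmp_dom A1) (Cmp_match Hp).
exists s; rewrite tf_comp2 comp2_assoc; split; first exact: Cmp_assocr A1 Hs Hp.
exact: Cmp_assocl B2 (Cmp_assocr A2 Hs B1) Hp'.
Qed.

Definition AlgCell_comp2 (X Y Z : TAlg) (b : AlgCell Y Z) (a : AlgCell X Y) :
  AlgCell X Z.
Proof.
refine (@MkAlgCell X Z (TMap_comp (adom b) (adom a)) (TMap_comp (acod b) (acod a))
          (ucell b ⋆ ucell a) _ _ (AlgCell_comp2_eq b a)).
- by rewrite dom_comp2 !ucell_dom.
- by rewrite cod_comp2 !ucell_cod.
Defined.

Definition Alg_hom (X Y : TAlg) : Category.
Proof.
refine (@MkCategory (TMap X Y) (AlgCell X Y) (@adom X Y) (@acod X Y)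
          (@AlgCell_id X Y) (@AlgCell_cmp X Y) _ _ _ _ _ _ _) => //.
- move=> a e; apply: AlgCell_eq => //=.
  by apply: Cmp_fun (CmpI _) _; apply: Cmp_idl; apply: ucell_cod.
- move=> a e; apply: AlgCell_eq => //=.
  by apply: Cmp_fun (CmpI _) _; apply: Cmp_idr; apply: ucell_dom.
- move=> c b a *; apply: AlgCell_eq => //=.
  by apply: Cmp_fun (CmpI _) _; apply: Cmp_assocr (CmpI _) (CmpI _) (CmpI _).
Defined.

Lemma Alg_Cmp (X Y : TAlg) (b a c : arr (Alg_hom X Y)) :
  Cmp b a c <->
  [/\ acod a = adom b, adom c = adom a, acod c = acod b &
      Cmp (ucell b) (ucell a) (ucell c)].
Proof.
split=> [[e <-]|[e e1 e2 H]]; first by split=> //; apply: CmpI.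
exists e; apply: AlgCell_eq => //=; exact: Cmp_fun (CmpI _) H.
Qed.

Lemma TMap_comp1l (X Y : TAlg) (f : TMap X Y) : TMap_comp (TMap_one Y) f = f.
Proof.
apply: TMap_eq => /=; first exact: comp1_1l.
apply: Cmp_fun (CmpI _) _ => /=.
rewrite comp2_1l tf_one comp1_1r comp2_id; apply: Cmp_idr; exact: um2_dom.
Qed.

Lemma TMap_comp1r (X Y : TAlg) (f : TMap X Y) : TMap_comp f (TMap_one X) = f.
Proof.
apply: TMap_eq => /=; first exact: comp1_1r.
apply: Cmp_fun (CmpI _) _ => /=.
rewrite tf_one comp1_1r comp2_1r comp2_id; apply: Cmp_idl; exact: um2_cod.
Qed.

Lemma TMap_compA (X Y Z W : TAlg) (h : TMap Z W) (g : TMap Y Z) (f : TMap X Y) :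
  TMap_comp h (TMap_comp g f) = TMap_comp (TMap_comp h g) f.
Proof.
apply: TMap_eq => /=; first exact: comp1_assoc.
apply: Cmp_fun (CmpI _) _ => /=.
have H1 := Cmp_wl (um h) (um2_comp g f).
have H2 := Cmp_wr (map1 T f) (um2_comp h g).
have H3 := um2_comp (TMap_comp h g) f.
have -> : map1 T (um g ∘ um f) = map1 T g ∘ map1 T f by apply: tf_comp1.
have e : \1 (um (TMap_comp h g)) = \1 (um h) ⋆ \1 (um g) by rewrite comp2_id.
rewrite e in H3; rewrite -comp2_id.
rewrite !comp2_assoc in H1 H2 H3 *.
exact: Cmp_assocl H2 H3 H1.
Qed.

Lemma TMap_one_strict (X : TAlg) : is_strict (TMap_one X).
Proof. by []. Qed.

Lemma TMap_comp_strict (X Y Z : TAlg) (g : TMap Y Z) (f : TMap X Y) :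
  is_strict g -> is_strict f -> is_strict (TMap_comp g f).
Proof.
move=> Hg Hf; apply: Cmp_fun (um2_comp g f) _.
rewrite Hg Hf /= tf_comp1 !comp2_id !comp1_assoc (is_strictP Hg).
by apply: Cmp_idl; rewrite cod_id.
Qed.

Definition Alg : TwoCat.
Proof.
refine (@MkTwoCat TAlg Alg_hom TMap_one (fun X Y Z g f => TMap_comp g f)
          (fun X Y Z b a => AlgCell_comp2 b a) _ _ _ _ _ _ _ _ _ _) => //.
- by move=> X Y Z g f; apply: AlgCell_eq => //=; rewrite comp2_id.
- move=> X Y Z b' b b'' a' a a'' /Alg_Cmp[h1 h2 h3 h4] /Alg_Cmp[k1 k2 k3 k4].
  apply/Alg_Cmp; split=> /=; rewrite ?h1 ?h2 ?h3 ?k1 ?k2 ?k3 //.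
  exact: interchange.
- exact: TMap_comp1l.
- exact: TMap_comp1r.
- exact: TMap_compA.
- by move=> X Y a; apply: AlgCell_eq;
    [exact: TMap_comp1l | exact: TMap_comp1l | exact: comp2_1l].
- by move=> X Y a; apply: AlgCell_eq;
    [exact: TMap_comp1r | exact: TMap_comp1r | exact: comp2_1r].
- by move=> X Y Z W c b a; apply: AlgCell_eq;
    [exact: TMap_compA | exact: TMap_compA | exact: comp2_assoc].
Defined.

(* T-Alg_s, and the inclusion i : T-Alg_s -> T-Alg. *)
Definition Algs : TwoCat :=
  @locally_full Alg (fun X Y f => is_strict f) TMap_one_strict
    (fun X Y Z g f => @TMap_comp_strict X Y Z g f).

Definition incl : TwoFunctor Algs Alg :=
  @lf_incl Alg (fun X Y f => is_strict f) TMap_one_strict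
    (fun X Y Z g f => @TMap_comp_strict X Y Z g f).

(* [SMap X Y] is convertible to the type of 1-cells X -> Y of [Algs]. *)
Definition SMap (X Y : TAlg) : Type := {f : TMap X Y | is_strict f}.
Definition smap (X Y : TAlg) (j : SMap X Y) : TMap X Y := proj1_sig j.

Record Classifier : Type := MkClassifier {
  cl_Q :> TwoFunctor Alg Algs;
  cl_adj : TwoAdj cl_Q incl }.

(* zeta_Y : Y -> i Q Y in T-Alg, and delta_Y : Q i Y -> Y in T-Alg_s. *)
Definition zeta (Q : Classifier) (Y : TAlg) : @hom Alg Y (Q Y) :=
  adj_unit (cl_adj Q) Y.
Definition delta (Q : Classifier) (Y : TAlg) : @hom Algs (Q Y) Y :=
  adj_counit (cl_adj Q) Y.

Definition admits_classifier : Prop := inhabited Classifier.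

Definition free (C : K) : TAlg :=
  @MkTAlg (T C) (mu T C) (mu_etar T C) (eq_sym (mu_assoc T C)).

(* The free map T phi, and the structure map of an algebra as maps of free algebras. *)
Definition free_map (C C' : K) (phi : hom C C') : TMap (free C) (free C') :=
  @strict_map (free C) (free C') (map1 T phi) (tn_nat1 (mu T) phi).

Definition mu_map (C : K) : TMap (free (T C)) (free C) :=
  @strict_map (free (T C)) (free C) (mu T C) (mu_assoc T C).

(* Morphisms phi -> psi of K^2. *)
Record Sq (C C' D D' : K) (phi : hom C C') (psi : hom D D') : Type := MkSq {
  sqR : hom C D;
  sqS : hom C' D';
  sq_eq : psi ∘ sqR = sqS ∘ phi }.

Definition sq_comp (C C' D D' E E' : K) (phi : hom C C') (psi : hom D D')
  (chi : hom E E') (n : Sq psi chi) (m : Sq phi psi) : Sq phi chi.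
Proof.
refine (@MkSq _ _ _ _ phi chi (sqR n ∘ sqR m) (sqS n ∘ sqS m) _).
by rewrite comp1_assoc sq_eq -comp1_assoc sq_eq comp1_assoc.
Defined.

(* Morphisms f -> g of T-Alg^{2,s}. *)
Record TSq (X Y X' Y' : TAlg) (f : TMap X Y) (g : TMap X' Y') : Type := MkTSq {
  tsqJ : SMap X X';
  tsqK : SMap Y Y';
  tsq_eq : TMap_comp g (smap tsqJ) = TMap_comp (smap tsqK) f }.

Definition forget_sq (X Y X' Y' : TAlg) (f : TMap X Y) (g : TMap X' Y')
  (m : TSq f g) : Sq (um f) (um g) :=
  @MkSq _ _ _ _ (um f) (um g) (um (smap (tsqJ m))) (um (smap (tsqK m)))
    (f_equal (@um _ _) (tsq_eq m)).

(* [up_bar] is the inverse of the function T-Alg^{2,s}(up_map, f) -> K^2(phi, u f)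
   that applies u and precomposes with (eta_C, up_kappa). *)
Record UnivPseudo (C C' : K) (phi : hom C C') : Type := MkUnivPseudo {
  up_alg : TAlg;
  up_map : TMap (free C) up_alg;
  up_kappa : hom C' up_alg;
  up_sq : um up_map ∘ eta T C = up_kappa ∘ phi;
  up_bar : forall (X Y : TAlg) (f : TMap X Y), Sq phi (um f) -> TSq up_map f;
  up_barK : forall (X Y : TAlg) (f : TMap X Y) (m : Sq phi (um f)),
    sq_comp (forget_sq (up_bar m)) (MkSq up_sq) = m;
  up_resK : forall (X Y : TAlg) (f : TMap X Y) (m : TSq up_map f),
    up_bar (sq_comp (forget_sq m) (MkSq up_sq)) = m }.

Definition admits_universal_pseudomorphisms : Prop :=
  forall (C C' : K) (phi : hom C C'), inhabited (UnivPseudo phi).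

Definition eta_sq (C C' : K) (phi : hom C C') : Sq phi (um (free_map phi)) :=
  @MkSq _ _ _ _ phi (um (free_map phi)) (eta T C) (eta T C')
    (eq_sym (tn_nat1 (eta T) phi)).

Definition Delta (C C' : K) (phi : hom C C') (u : UnivPseudo phi) :
  SMap (up_alg u) (free C') := tsqK (up_bar u (eta_sq phi)).

Section PFree.
Variable U : forall (C C' : K) (phi : hom C C'), UnivPseudo phi.

Definition Pob (C : K) : TAlg := up_alg (U (one C)).

Definition Pmap_sq (C C' : K) (f : TMap (free C) (free C')) :
  Sq (one C) (um (TMap_comp (up_map (U (one C'))) f)) :=
  @MkSq _ _ _ _ (one C) (um (TMap_comp (up_map (U (one C'))) f)) (eta T C)
    (um (up_map (U (one C'))) ∘ um f ∘ eta T C) (eq_sym (comp1_1r _)).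

Definition Pmap (C C' : K) (f : TMap (free C) (free C')) : SMap (Pob C) (Pob C') :=
  tsqK (up_bar (U (one C)) (Pmap_sq f)).

Lemma free_strict_ext (C : K) (X : TAlg) (f g : TMap (free C) X) :
  is_strict f -> is_strict g -> um f ∘ eta T C = um g ∘ eta T C -> f = g.
Proof.
have ext (h : TMap (free C) X) : is_strict h ->
    um h = act X ∘ map1 T (um h ∘ eta T C).
  move=> Hh; rewrite tf_comp1 comp1_assoc (is_strictP Hh) -comp1_assoc /=.
  by rewrite mu_etal comp1_1r.
move=> Hf Hg e; have e1 : um f = um g by rewrite (ext f Hf) (ext g Hg) e.
by apply: TMap_eq; rewrite ?Hf ?Hg ?e1.
Qed.

(* The first component of the morphism defining [Pmap f] is the identity. *)
Lemma Pmap_fst (C C' : K) (f : TMap (free C) (free C')) :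
  smap (tsqJ (up_bar (U (one C)) (Pmap_sq f))) = TMap_one (free C).
Proof.
apply: free_strict_ext; [exact: proj2_sig | exact: TMap_one_strict |].
have := f_equal (@sqR _ _ _ _ _ _) (up_barK (U (one C)) (Pmap_sq f)).
by rewrite /= comp1_1l.
Qed.

Lemma Pmap_square (C C' : K) (f : TMap (free C) (free C')) :
  TMap_comp (up_map (U (one C'))) f =
  TMap_comp (smap (Pmap f)) (up_map (U (one C))).
Proof. by have := tsq_eq (up_bar (U (one C)) (Pmap_sq f)); rewrite Pmap_fst TMap_comp1r. Qed.

Definition admits_coequalizers_of_Pfree_pairs : Prop :=
  forall X : TAlg, exists (Z : Algs) (q : @hom Algs (Pob X) Z),
    @is_coequalizer1 Algs (Pob (T X)) (Pob X)
      (Pmap (mu_map X)) (Pmap (free_map (act X))) Z q.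

End PFree.
End Algebras.

(* Main.v *)
From Stdlib Require Import ssreflect ssrbool ssrfun ProofIrrelevance FunctionalExtensionality
  ClassicalEpsilon.
Require Import Defs.

(* A T-map out of X corresponds to a strict map out of QX.

   (C), (D).  The pseudolimit of a T-map lifts to T-algebras with strict projections.
   The pseudolimit M of zeta_Y receives a T-map from Y induced by the identity 2-cell of
   zeta_Y; the corresponding strict map QY -> M classifies the 2-cell Theta.  A T-map g
   out of TC is isomorphic, by g_bullet * T(eta), to the strict map with the same
   restriction along eta; applied to g the universal pseudomorphism of phi, this gives a
   T-map from TC to the pseudolimit of the identity of T(C',phi), and the universal
   property of T(C',phi) turns it into an isomorphism between the identity and Delta followed
   by its section.

   (A) => (B).  T(C',phi) is the pushout of T(phi) and of the strict map TC -> QTC that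
   extends zeta * eta.

   (B) => (A).  PC plays the role of QTC.  Since X is the coequalizer of T^2X => TX in
   T-Alg, for pseudomorphisms as well, the coequalizer of the P-free pair classifies T-maps
   out of X.  Cotensors with the free arrow reduce the 2-dimensional part of the universal
   property to the 1-dimensional one, because a 2-cell into Y is a 1-cell into {2,Y}. *)

Set Implicit Arguments.
Unset Strict Implicit.
Unset Printing Implicit Defensive.
Set SsrOldRewriteGoalsOrder.

(** * Calculus of vertical and horizontal composites of 2-cells *)

Section VerticalComposite.
Variable C : Category.
Implicit Types a b c : arr C.

(* Total composition; the junk value on non-composable pairs is [b]. *)
Definition vc b a : arr C :=
  match excluded_middle_informative (cod a = dom b) with
  | left e => cmp b a e
  | right _ => b
  end.

Lemma Cmp_vc b a : cod a = dom b -> Cmp b a (vc b a).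
Proof.
rewrite /vc; case: excluded_middle_informative => // e _; exact: CmpI.
Qed.

Lemma vcE b a c : Cmp b a c -> vc b a = c.
Proof. by move=> H; apply: Cmp_fun (Cmp_vc (Cmp_match H)) H. Qed.

Lemma dom_vc b a : cod a = dom b -> dom (vc b a) = dom a.
Proof. by move=> e; apply: Cmp_dom (Cmp_vc e). Qed.

Lemma cod_vc b a : cod a = dom b -> cod (vc b a) = cod b.
Proof. by move=> e; apply: Cmp_cod (Cmp_vc e). Qed.

Lemma vc1l (x : C) a : cod a = x -> vc (\1 x) a = a.
Proof. by move=> e; apply: vcE; apply: Cmp_idl. Qed.

Lemma vc1r (x : C) a : dom a = x -> vc a (\1 x) = a.
Proof. by move=> e; apply: vcE; apply: Cmp_idr. Qed.

Lemma vcA c b a : cod a = dom b -> cod b = dom c -> vc c (vc b a) = vc (vc c b) a.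
Proof.
move=> e1 e2; apply: vcE; apply: Cmp_assocr (Cmp_vc e2) _ (Cmp_vc e1).
by apply: Cmp_vc; rewrite dom_vc.
Qed.

Lemma invertible_inv a : invertible a ->
  exists b, [/\ dom b = cod a, cod b = dom a, vc b a = \1 (dom a) & vc a b = \1 (cod a)].
Proof.
move=> [b [H1 H2]]; exists b; split; [| |exact: vcE|exact: vcE].
- by rewrite (Cmp_match H1).
- exact: Cmp_match H2.
Qed.

Lemma invertibleI a b : dom b = cod a -> cod b = dom a ->
  vc b a = \1 (dom a) -> vc a b = \1 (cod a) -> invertible a.
Proof. by move=> e1 e2 e3 e4; exists b; rewrite -e3 -e4; split; apply: Cmp_vc. Qed.

Lemma invertible_vc b a :
  cod a = dom b -> invertible b -> invertible a -> invertible (vc b a).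
Proof. by move=> e; apply: invertible_Cmp; apply: Cmp_vc. Qed.

(** Used to verify equations of pasted 2-cells after composing with a structure 2-cell, which is
    always invertible. *)
Lemma invertible_epi a b b' : invertible a -> cod a = dom b -> cod a = dom b' ->
  vc b a = vc b' a -> b = b'.
Proof.
move=> /invertible_inv[i [di ci _ ai]] e e' E.
by rewrite -(vc1r (esym e)) -(vc1r (esym e')) -ai !vcA ?E.
Qed.

End VerticalComposite.

Notation "b • a" := (vc b a) (at level 45, right associativity).

Lemma fa_vc (C D : Category) (F : Functor C D) (b a : arr C) :
  cod a = dom b -> fa F (b • a) = fa F b • fa F a.
Proof. by move=> e; apply/esym/vcE/fa_cmp/Cmp_vc. Qed.

Lemma invertible_fa (C D : Category) (F : Functor C D) (a : arr C) :
  invertible a -> invertible (fa F a).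
Proof.
move=> [b [H1 H2]]; exists (fa F b).
by rewrite dom_fa cod_fa -!fa_id; split; apply: fa_cmp.
Qed.

Lemma Functor_eq (C D : Category) (F G : Functor C D) :
  (forall x, F x = G x) -> (forall f, fa F f = fa G f) -> F = G.
Proof.
case: F => F0 F1 p q r s; case: G => G0 G1 p' q' r' s' /= e0 e1.
have E0 : F0 = G0 by apply: functional_extensionality.
have E1 : F1 = G1 by apply: functional_extensionality.
by subst F0 F1; f_equal; apply: proof_irrelevance.
Qed.

Section HorizontalComposite.
Variables (K : TwoCat).

Lemma comp2_vc (A B C : K) (b' b : cell B C) (a' a : cell A B) :
  cod b = dom b' -> cod a = dom a' -> (b' • b) ⋆ (a' • a) = (b' ⋆ a') • (b ⋆ a).
Proof. by move=> e e'; apply/esym/vcE/interchange; apply: Cmp_vc. Qed.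

Lemma wl_vc (A B C : K) (h : hom B C) (b a : cell A B) :
  cod a = dom b -> \1 h ⋆ (b • a) = (\1 h ⋆ b) • (\1 h ⋆ a).
Proof. by move=> e; rewrite -comp2_vc ?vc1l ?cod_id ?dom_id. Qed.

Lemma wr_vc (A B C : K) (h : hom A B) (b a : cell B C) :
  cod a = dom b -> (b • a) ⋆ \1 h = (b ⋆ \1 h) • (a ⋆ \1 h).
Proof. by move=> e; rewrite -comp2_vc ?vc1l ?cod_id ?dom_id. Qed.

(** One of the two whiskered forms of a horizontal composite. The boundaries are variables with
    equations, since they often agree only propositionally. *)
Lemma comp2_right_left (A B C : K) (b : cell B C) (a : cell A B) x y :
  x = dom b -> y = cod a -> b ⋆ a = (b ⋆ \1 y) • (\1 x ⋆ a).
Proof. by move=> -> ->; rewrite -comp2_vc ?vc1l ?vc1r ?cod_id ?dom_id. Qed.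

Lemma comp2_left_right (A B C : K) (b : cell B C) (a : cell A B) x y :
  x = cod b -> y = dom a -> b ⋆ a = (\1 x ⋆ a) • (b ⋆ \1 y).
Proof. by move=> -> ->; rewrite -comp2_vc ?vc1l ?vc1r ?cod_id ?dom_id. Qed.

End HorizontalComposite.

(** Proves equations between boundaries of pasted 2-cells. The composability of each vertical
    composite is solved recursively, and composites of 1-cells are associated to the right before
    [congruence]. *)
Ltac boundary :=
  repeat first
    [ rewrite dom_comp2 | rewrite cod_comp2 | rewrite dom_id | rewrite cod_id
    | rewrite dom_fa | rewrite cod_fa
    | match goal with
      | H : dom ?x = _ |- context [dom ?x] => rewrite H
      | H : cod ?x = _ |- context [cod ?x] => rewrite H
      end
    | rewrite um2_dom | rewrite um2_cod | rewrite ucell_dom | rewrite ucell_cod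
    | rewrite dom_vc; [|solve [boundary]] | rewrite cod_vc; [|solve [boundary]] ];
  rewrite /= ?tf_comp1 -?comp1_assoc; try congruence.

(** * Pseudolimits and arrow cotensors as instances of one limit notion *)

(* [inv := True] gives the pseudolimit of f; [inv := False] with f an identity
   gives the cotensor with the free arrow. *)
Record is_limit (inv : Prop) (K : TwoCat) (A B : K) (f : hom A B)
    (L : K) (a : hom L A) (b : hom L B) (l : cell L B) : Prop := IsLimit {
  lim_dom : dom l = f ∘ a;
  lim_cod : cod l = b;
  lim_inv : inv -> invertible l;
  lim_ex1 : forall (X : K) (a' : hom X A) (l' : cell X B),
    dom l' = f ∘ a' -> (inv -> invertible l') ->
    exists h : hom X L, a ∘ h = a' /\ l ⋆ \1 h = l';
  lim_uniq1 : forall (X : K) (h h' : hom X L),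
    a ∘ h = a ∘ h' -> l ⋆ \1 h = l ⋆ \1 h' -> h = h';
  lim_ex2 : forall (X : K) (h h' : hom X L) (p : cell X A) (q : cell X B),
    dom p = a ∘ h -> cod p = a ∘ h' -> dom q = b ∘ h -> cod q = b ∘ h' ->
    (l ⋆ \1 h') • (\1 f ⋆ p) = q • (l ⋆ \1 h) ->
    exists r : cell X L, [/\ dom r = h, cod r = h', \1 a ⋆ r = p & \1 b ⋆ r = q];
  lim_uniq2 : forall (X : K) (r r' : cell X L),
    dom r = dom r' -> cod r = cod r' ->
    \1 a ⋆ r = \1 a ⋆ r' -> \1 b ⋆ r = \1 b ⋆ r' -> r = r' }.

Section Limit.
Variables (inv : Prop) (K : TwoCat) (A B : K) (f : hom A B).
Variables (L : K) (a : hom L A) (b : hom L B) (l : cell L B).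

(** Both sides are the horizontal composite [l ⋆ r]. *)
Lemma limit_nat (X : K) (r : cell X L) : dom l = f ∘ a -> cod l = b ->
  (l ⋆ \1 (cod r)) • (\1 f ⋆ (\1 a ⋆ r)) = (\1 b ⋆ r) • (l ⋆ \1 (dom r)).
Proof.
move=> dl cl; rewrite comp2_assoc comp2_id -(comp2_right_left (esym dl)) //.
exact: comp2_left_right.
Qed.

Hypothesis HL : is_limit inv f a b l.
Let dl := lim_dom HL.
Let cl := lim_cod HL.

(** The inverses of the two projections are compatible with [l], so they induce a 2-cell, which is
    inverse to [r] by uniqueness. *)
Lemma limit_invertible (X : K) (r : cell X L) :
  invertible (\1 a ⋆ r) -> invertible (\1 b ⋆ r) -> invertible r.
Proof.
move=> /invertible_inv[p' []]; rewrite dom_comp2 cod_comp2 dom_id cod_id => dp cp p'p pp'.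
move=> /invertible_inv[q' []]; rewrite dom_comp2 cod_comp2 dom_id cod_id => dq cq q'q qq'.
have N := limit_nat r dl cl.
have dN : dom (l ⋆ \1 (dom r)) = f ∘ a ∘ dom r by rewrite dom_comp2 dl dom_id.
have cN : cod (l ⋆ \1 (dom r)) = b ∘ dom r by rewrite cod_comp2 cl cod_id.
have dN' : dom (l ⋆ \1 (cod r)) = f ∘ a ∘ cod r by rewrite dom_comp2 dl dom_id.
have cN' : cod (l ⋆ \1 (cod r)) = b ∘ cod r by rewrite cod_comp2 cl cod_id.
(* The square of [limit_nat] for [r], conjugated by the inverses [p'] and [q']. *)
have E : (l ⋆ \1 (dom r)) • (\1 f ⋆ p') = q' • (l ⋆ \1 (cod r)).
  rewrite -[LHS](@vc1l _ (b ∘ dom r)); last by boundary.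
  rewrite -q'q -vcA; [|by boundary..].
  rewrite [(\1 b ⋆ r) • _]vcA; [|by boundary..].
  rewrite -N -vcA; [|by boundary..].
  rewrite -wl_vc ?pp' ?comp2_id; last by boundary.
  by rewrite vc1r //; boundary.
have [r' [dr cr rp rq]] := lim_ex2 HL dp cp dq cq E.
apply: (@invertibleI _ r r') => //; apply: (lim_uniq2 HL);
  by rewrite ?wl_vc ?comp2_id ?rp ?rq ?p'p ?pp' ?q'q ?qq'; boundary.
Qed.
End Limit.

(** The second leg of a cone is the codomain of its 2-cell, so the first leg and the 2-cell carry
    all the data. *)
Lemma pseudolimit_limit (K : TwoCat) (A B : K) (f : hom A B)
    (L : K) (a : hom L A) (b : hom L B) (l : cell L B) :
  is_pseudolimit f a b l -> is_limit True f a b l.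
Proof.
move=> [[dl [cl il]] [U1 U2]]; split=> //.
- move=> X a' l' dl' il'.
  have [h [[e1 [_ e3]] _]] := U1 X a' _ l' dl' erefl (il' I).
  by exists h.
- move=> X h h' ea el.
  have eb : b ∘ h = b ∘ h' by have := f_equal cod el; rewrite !cod_comp2 !cod_id cl.
  have [|//|//|g [_ U]] := U1 X (a ∘ h') (b ∘ h') (l ⋆ \1 h').
  + by boundary.
  + by boundary.
  + by apply: invertible_comp2 => //; apply: invertible_id.
  + by rewrite -(U h) ?(U h').
- move=> X h h' p q dp cp dq cq e.
  have [|||||r [[? [? [? ?]]] _]] := U2 X h h' p q => //; last by exists r.
  exists (q • (l ⋆ \1 h)); split; last by apply: Cmp_vc; boundary.
  by rewrite -e; apply: Cmp_vc; boundary.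
- move=> X r r' ed ec ea eb.
  have [|||||g [_ U]] := U2 X (dom r) (cod r) (\1 a ⋆ r) (\1 b ⋆ r).
  1-4: by boundary.
  + exists ((\1 b ⋆ r) • (l ⋆ \1 (dom r))); split; last by apply: Cmp_vc; boundary.
    by rewrite -(limit_nat r dl cl); apply: Cmp_vc; boundary.
  + by rewrite -(U r) ?(U r').
Qed.

(** * Functors out of the free arrow and cotensors with it *)

Definition the_arrow : arr arrow_cat :=
  exist (fun p : bool * bool => p.1 = true -> p.2 = true) (false, true) (fun _ => erefl).

Lemma arrow_Functor_eq (C : Category) (F G : Functor arrow_cat C) :
  fa F the_arrow = fa G the_arrow -> F = G.
Proof.
move=> e.
have E x : F x = G x.
  case: x; first by have := f_equal cod e; rewrite !cod_fa.
  by have := f_equal dom e; rewrite !dom_fa.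
apply: Functor_eq => // -[[[] []] r] /=.
- have -> : exist _ (true, true) r = @idm arrow_cat true by apply: subset_eq_compat.
  by rewrite !fa_id E.
- by have := r erefl.
- by have -> : exist _ (false, true) r = the_arrow by apply: subset_eq_compat.
- have -> : exist _ (false, false) r = @idm arrow_cat false by apply: subset_eq_compat.
  by rewrite !fa_id E.
Qed.

(** The pair [(true, false)], which is no arrow, falls under the identity case of the match. *)
Definition arrow_functor (C : Category) (l : arr C) : Functor arrow_cat C.
Proof.
refine (@MkFunctor arrow_cat C (fun x => if x then cod l else dom l)
  (fun r => match proj1_sig r with
            | (false, true) => l
            | (x, _) => \1 (if x then cod l else dom l)
            end) _ _ _ _).
- by move=> [[[] []] r] //=; rewrite dom_id.
- by move=> [[[] []] r] //=; rewrite ?cod_id //; have := r erefl.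
- by case.
- move=> [[y' z] s] [[x y] r] c [/= e <-] /=; subst y'.
  case: x y z r s => [] [] [] /= r s;
    try (by have := r erefl); try (by have := s erefl);
    by first [apply: Cmp_idl; rewrite ?cod_id | apply: Cmp_idr; rewrite ?dom_id].
Defined.

(** A Yoneda argument: the functor [F0] corresponding to the identity of [L] is universal, and [l]
    is its value on the free arrow. *)
Lemma cotensor_limit (K : TwoCat) (X L : K) : is_cotensor arrow_cat X L ->
  exists (a b : hom L X) (l : cell L X), is_limit False (one X) a b l.
Proof.
move=> c; pose cF A := cot_iso c A.
have inj0 A F G : cot c A F = cot c A G -> F = G.
  by have [G' [g1 _]] := cF A => e; rewrite -(g1 F) e g1.
have inj1 A n m : fa (cot c A) n = fa (cot c A) m -> n = m.
  by have [G' [_ [_ [g1 _]]]] := cF A => e; rewrite -(g1 n) e g1.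
have [F0 EF] : exists F0, cot c L F0 = one L.
  by have [G' [_ [g _]]] := cF L; exists (G' (one L)).
(* By 2-naturality, every 1-cell and every 2-cell into [L] corresponds to a restriction of [F0] or
   of its identity. *)
have E1 A (h : hom A L) : cot c A (compF (precomp X h) F0) = h.
  by rewrite cot_nat1 EF comp1_1l.
have E2 A (r : cell A L) : fa (cot c A) (nat_hcomp (nat_id F0) r) = r.
  rewrite (cot_nat2 c (nat_id F0) r).
  have -> : nat_id F0 = idm (F0 : FunCat arrow_cat (hom L X)) by [].
  by rewrite fa_id EF comp2_1l.
pose l := fa F0 the_arrow.
have dl : dom l = F0 false by rewrite dom_fa.
have cl : cod l = F0 true by rewrite cod_fa.
exists (F0 false), (F0 true), l; split=> //.
- by rewrite comp1_1l.
- move=> A a' l' dl' _; rewrite comp1_1l in dl'.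
  have e := E1 A (cot c A (arrow_functor l')); move/inj0: e => e.
  exists (cot c A (arrow_functor l')); split.
  + by have := f_equal (fun F : Functor arrow_cat (hom A X) => F false) e; rewrite /= dl'.
  + by have := f_equal (fun F : Functor arrow_cat (hom A X) => fa F the_arrow) e.
- move=> A h h' _ e; rewrite -(E1 A h) -(E1 A h'); f_equal.
  exact: arrow_Functor_eq.
- move=> A h h' p q dp cp dq cq.
  rewrite comp2_1l => E.
  (* The equation [E] is naturality, at the free arrow, of the transformation with components [p]
     and [q]. *)
  have N : exists n : NatTrans arrow_cat (hom A X),
    [/\ nsrc n = compF (precomp X h) F0, ntgt n = compF (precomp X h') F0,
        ncomp n false = p & ncomp n true = q].
    unshelve eexists (@MkNatTrans arrow_cat (hom A X)
      (compF (precomp X h) F0) (compF (precomp X h') F0)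
      (fun x => if x then q else p) _ _ _) => //.
    + by case.
    + by case.
    + move=> [[[] []] r] /=.
      * have -> : exist _ (true, true) r = @idm arrow_cat true by apply: subset_eq_compat.
        by rewrite !fa_id !comp2_id; exists q; split; [apply: Cmp_idl|apply: Cmp_idr].
      * by have := r erefl.
      * have -> : exist _ (false, true) r = the_arrow by apply: subset_eq_compat.
        by exists (q • (l ⋆ \1 h)); rewrite -{1}E; split; apply: Cmp_vc; boundary.
      * have -> : exist _ (false, false) r = @idm arrow_cat false by apply: subset_eq_compat.
        by rewrite !fa_id !comp2_id; exists p; split; [apply: Cmp_idl|apply: Cmp_idr].
    + have [n [n1 n2 n3 n4]] := N.
      have e := E2 A (fa (cot c A) n); move/inj1: e => e.
      exists (fa (cot c A) n); split.
      * by rewrite dom_fa /= n1.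
      * by rewrite cod_fa /= n2.
      * by rewrite -n3 -[in RHS]e.
      * by rewrite -n4 -[in RHS]e.
- move=> A r r' ed ec ea eb; rewrite -(E2 A r) -(E2 A r'); f_equal.
  by apply: NatTrans_eq => /=; [rewrite ed|rewrite ec|case].
Qed.

(** * Pasting of algebra 2-cells *)

Section AlgebraCalculus.
Variables (K : TwoCat) (T : TwoMonad K).

Lemma um2_compE (X Y Z : TAlg T) (g : TMap Y Z) (f : TMap X Y) :
  um2 (TMap_comp g f) = (\1 (um g) ⋆ um2 f) • (um2 g ⋆ \1 (map1 T f)).
Proof. by rewrite (vcE (um2_comp g f)). Qed.

Lemma um2_multE (X Y : TAlg T) (f : TMap X Y) :
  (um2 f ⋆ \1 (map1 T (act X))) • (\1 (act Y) ⋆ map2 T (um2 f)) = um2 f ⋆ \1 (mu T X).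
Proof. exact: vcE (um2_mult f). Qed.

Lemma um2_comp_strictl (X Y Z : TAlg T) (g : TMap Y Z) (f : TMap X Y) :
  is_strict g -> um2 (TMap_comp g f) = \1 (um g) ⋆ um2 f.
Proof.
move=> Hg; rewrite um2_compE Hg comp2_id vc1r //.
by boundary; rewrite !comp1_assoc (is_strictP Hg).
Qed.

Lemma um2_comp_strictr (X Y Z : TAlg T) (g : TMap Y Z) (f : TMap X Y) :
  is_strict f -> um2 (TMap_comp g f) = um2 g ⋆ \1 (map1 T f).
Proof.
move=> Hf; rewrite um2_compE Hf comp2_id vc1l //.
by boundary; rewrite (is_strictP Hf).
Qed.

Lemma ucell_eqE (X Y : TAlg T) (al : AlgCell X Y) :
  (ucell al ⋆ \1 (act X)) • um2 (adom al) =
  um2 (acod al) • (\1 (act Y) ⋆ map2 T (ucell al)).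
Proof. by have [c [H1 H2]] := ucell_eq al; rewrite (vcE H1) (vcE H2). Qed.

Definition MkCell (X Y : TAlg T) (f g : TMap X Y) (c : cell X Y)
  (dc : dom c = um f) (cc : cod c = um g)
  (e : (c ⋆ \1 (act X)) • um2 f = um2 g • (\1 (act Y) ⋆ map2 T c)) : AlgCell X Y.
Proof.
refine (@MkAlgCell K T X Y f g c dc cc _).
exists ((c ⋆ \1 (act X)) • um2 f); split; first by apply: Cmp_vc; boundary.
by rewrite e; apply: Cmp_vc; boundary.
Defined.

(** The inverse in K satisfies the algebra condition automatically. *)
Lemma AlgCell_invertible (X Y : TAlg T) (al : AlgCell X Y) :
  invertible (ucell al) -> @invertible (Alg_hom X Y) al.
Proof.
move=> /invertible_inv[i [di ci ia ai]].
have dal := ucell_dom al; have cal := ucell_cod al.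
have e : (i ⋆ \1 (act X)) • um2 (acod al) = um2 (adom al) • (\1 (act Y) ⋆ map2 T i).
  have inv : invertible (\1 (act Y) ⋆ map2 T (ucell al)).
    apply: invertible_comp2; first exact: invertible_id.
    by apply: invertible_fa; apply: (invertibleI di ci).
  (* Composed with [act Y ⋆ T al], the condition for [i] reduces to the one for [al]. *)
  apply: (invertible_epi inv); [by boundary..|].
  rewrite -vcA; [|by boundary..].
  rewrite -ucell_eqE vcA; [|by boundary..].
  rewrite -wr_vc ?ia; last by boundary.
  rewrite comp2_id vc1l; last by boundary.
  rewrite -vcA; [|by boundary..].
  rewrite -wl_vc; last by boundary.
  rewrite -fa_vc ?ia; last by boundary.
  by rewrite fa_id comp2_id vc1r //; boundary.
pose be : AlgCell X Y := @MkCell X Y (acod al) (adom al) i (eq_trans di cal) (eq_trans ci dal) e.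
exists be; split; apply/Alg_Cmp; split=> //=.
- by rewrite -dal -ia; apply: Cmp_vc.
- by rewrite -cal -ai; apply: Cmp_vc.
Qed.

(* The 2-cell is [um2 g ⋆ \1 (T eta)]. *)
Lemma strictification_cell (C : K) (X : TAlg T) (s g : TMap (free T C) X) :
  is_strict s -> um s ∘ eta T C = um g ∘ eta T C ->
  exists al : AlgCell (free T C) X, [/\ adom al = s, acod al = g,
    invertible (ucell al) & ucell al ⋆ \1 (eta T C) = \1 (um g ∘ eta T C)].
Proof.
move=> Hs e.
have /= dg := um2_dom g; have /= cg := um2_cod g.
have es : um s = act X ∘ map1 T (um g) ∘ map1 T (eta T C).
  rewrite -comp1_assoc -tf_comp1 -e tf_comp1 comp1_assoc (is_strictP Hs) -comp1_assoc /=.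
  by rewrite mu_etal comp1_1r.
pose c : cell (T C) X := um2 g ⋆ \1 (map1 T (eta T C)).
have dc : dom c = um s by rewrite /c es; boundary.
have cc : cod c = um g by rewrite /c; boundary; rewrite mu_etal comp1_1r.
(* This is multiplicativity of [g] whiskered with [T T eta]; the strict [s] contributes an
   identity. *)
have E : (c ⋆ \1 (mu T C)) • um2 s = um2 g • (\1 (act X) ⋆ map2 T c).
  rewrite Hs vc1r; last by rewrite dom_comp2 dc dom_id (is_strictP Hs).
  rewrite /c tf_comp2 fa_id comp2_assoc.
  have -> : um2 g ⋆ \1 (map1 T (eta T C)) ⋆ \1 (mu T C) =
            um2 g ⋆ \1 (mu T (T C)) ⋆ \1 (map1 T (map1 T (eta T C))).
    by rewrite -!comp2_assoc !comp2_id; have /= -> := tn_nat1 (mu T) (eta T C).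
  have /= <- := um2_multE g.
  rewrite wr_vc; last by boundary.
  f_equal; rewrite -comp2_assoc comp2_id -tf_comp1 mu_etal tf_one.
  exact: comp2_1r.
exists (@MkCell (free T C) X s g c dc cc E); split=> //=.
- by apply: invertible_comp2; [exact: um2_inv | exact: invertible_id].
- rewrite /c -comp2_assoc comp2_id.
  have /= <- := tn_nat1 (eta T) (eta T C).
  by rewrite -comp2_id comp2_assoc (um2_unit g) comp2_id.
Qed.

End AlgebraCalculus.

(** * Limits of T-maps *)

(** [alim_mono] speaks of 1-cells of K because the squares defining maps out of [T(C',phi)] are
    equations in K. [alim_strict] makes a T-map classifying a 2-cell between strict maps strict. *)
Record is_alg_limit (inv : Prop) (K : TwoCat) (T : TwoMonad K) (A B : TAlg T)
    (f : TMap A B) (M : TAlg T) (a : SMap M A) (b : SMap M B) (l : AlgCell M B) : Prop :=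
  IsAlgLimit {
  alim_dom : adom l = TMap_comp f (smap a);
  alim_cod : acod l = smap b;
  alim_inv : inv -> invertible (ucell l);
  alim_ex : forall (X : TAlg T) (a' : TMap X A) (l' : AlgCell X B),
    adom l' = TMap_comp f a' -> (inv -> invertible (ucell l')) ->
    exists h : TMap X M,
      TMap_comp (smap a) h = a' /\ AlgCell_comp2 l (AlgCell_id h) = l';
  alim_uniq : forall (X : TAlg T) (h h' : TMap X M),
    TMap_comp (smap a) h = TMap_comp (smap a) h' ->
    AlgCell_comp2 l (AlgCell_id h) = AlgCell_comp2 l (AlgCell_id h') -> h = h';
  alim_mono : forall (X : K) (h h' : hom X M),
    um (smap a) ∘ h = um (smap a) ∘ h' -> ucell l ⋆ \1 h = ucell l ⋆ \1 h' -> h = h';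
  alim_strict : forall (X : TAlg T) (h : TMap X M),
    is_strict (TMap_comp (smap a) h) -> is_strict (TMap_comp (smap b) h) ->
    is_strict h }.

Section Lifting.
Variables (inv : Prop) (K : TwoCat) (T : TwoMonad K) (A B : TAlg T) (f : TMap A B).
Variables (L : K) (a : hom L A) (b : hom L B) (l : cell L B).
Hypothesis HL : is_limit inv (um f) a b l.
Let dl := lim_dom HL.
Let cl := lim_cod HL.

(** The action is chosen so that [a] becomes strict and [l] an algebra 2-cell; invertibility of
    [um2 f] lets this condition be solved for [l ⋆ \1 s]. *)
Lemma limit_act_ex : exists s : hom (T L) L,
  a ∘ s = act A ∘ map1 T a /\
  (l ⋆ \1 s) • (um2 f ⋆ \1 (map1 T a)) = \1 (act B) ⋆ map2 T l.
Proof.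
pose w := um2 f ⋆ \1 (map1 T a).
have iw : invertible w.
  by apply: invertible_comp2; [exact: um2_inv | exact: invertible_id].
have [w' [dw cw w'w ww']] := invertible_inv iw.
have iw' : invertible w' by apply: (invertibleI (b := w)); rewrite ?dw ?cw.
have Dw : dom w = act B ∘ map1 T (um f) ∘ map1 T a by rewrite /w; boundary.
have Cw : cod w = um f ∘ act A ∘ map1 T a by rewrite /w; boundary.
rewrite Cw in dw; rewrite Dw in cw.
(* The 2-cell [f ∘ act A ∘ T a => act B ∘ T b] that [s] has to classify. *)
pose m := (\1 (act B) ⋆ map2 T l) • w'.
have dm : dom m = um f ∘ (act A ∘ map1 T a) by rewrite /m; boundary.
have [|s [e1 e2]] := lim_ex1 HL dm.
  move=> /(lim_inv HL) il; apply: invertible_vc => //; first by boundary.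
  apply: invertible_comp2; first exact: invertible_id.
  exact: invertible_fa.
exists s; split=> //; rewrite e2 -/w /m -vcA; [|by boundary..].
by rewrite w'w vc1r //; boundary.
Qed.

Variable s : hom (T L) L.
Hypothesis sa : a ∘ s = act A ∘ map1 T a.
Hypothesis sl : (l ⋆ \1 s) • (um2 f ⋆ \1 (map1 T a)) = \1 (act B) ⋆ map2 T l.

Lemma limit_sb : b ∘ s = act B ∘ map1 T b.
Proof.
have := f_equal cod sl; rewrite cod_vc; last by boundary; rewrite -sa; boundary.
by boundary.
Qed.

Lemma limit_saX (X : K) (h : hom X (T L)) : a ∘ (s ∘ h) = act A ∘ (map1 T a ∘ h).
Proof. by rewrite comp1_assoc sa comp1_assoc. Qed.

(** Tested on [a] and [l]: in [sl] whiskered with [eta], the unit law of [f] turns the factor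
    [um2 f] into an identity. *)
Lemma limit_act_unit : s ∘ eta T L = one L.
Proof.
have Na := tn_nat1 (eta T) a; rewrite /= in Na.
have ea : a ∘ (s ∘ eta T L) = a.
  by rewrite comp1_assoc sa -comp1_assoc -Na comp1_assoc act_unit comp1_1l.
apply: (lim_uniq1 HL); rewrite ?comp1_1r // comp2_1r.
have := f_equal (fun c => c ⋆ \1 (eta T L)) sl.
rewrite wr_vc; last by boundary.
rewrite -comp2_assoc -[X in _ • X]comp2_assoc !comp2_id -Na.
have -> : um2 f ⋆ \1 (eta T A ∘ a) = \1 (um f ∘ a).
  by rewrite -comp2_id comp2_assoc um2_unit comp2_id.
rewrite vc1r; last by boundary; rewrite ea.
move=> ->; rewrite -comp2_assoc.
have /= <- := tn_nat2 (eta T) l.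
by rewrite comp2_assoc comp2_id act_unit comp2_1l.
Qed.

(** Tested on [a] and [l]. Three forms of [sl] (whiskered with [mu], whiskered with [T s], and its
    image under [T]) are glued by multiplicativity of [f]. *)
Lemma limit_act_mult : s ∘ mu T L = s ∘ map1 T s.
Proof.
have Na := tn_nat1 (mu T) a; rewrite /= in Na.
have iw : invertible (um2 f ⋆ \1 (map1 T a ∘ mu T L)).
  by apply: invertible_comp2; [exact: um2_inv | exact: invertible_id].
have Tsa : map1 T a ∘ map1 T s = map1 T (act A) ∘ map1 T (map1 T a).
  by rewrite -tf_comp1 sa tf_comp1.
have ea : a ∘ (s ∘ mu T L) = a ∘ (s ∘ map1 T s).
  by rewrite !limit_saX Tsa -Na [LHS]comp1_assoc act_mult comp1_assoc.
apply: (lim_uniq1 HL) => //.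
(* After this composition both sides equal [act B ∘ mu] whiskered with [T T l]. *)
apply: (invertible_epi iw); [by boundary; rewrite -?ea ?limit_saX..|].
have E1 := f_equal (fun c => c ⋆ \1 (mu T L)) sl.
rewrite wr_vc in E1; last by boundary.
rewrite -!comp2_assoc !comp2_id in E1; rewrite E1.
have E2 := f_equal (fun c => c ⋆ \1 (map1 T s)) sl.
rewrite wr_vc in E2; last by boundary.
rewrite -!comp2_assoc !comp2_id Tsa in E2.
have E3 := f_equal (fun c => \1 (act B) ⋆ map2 T c) sl.
rewrite /= fa_vc in E3; last by boundary.
rewrite !tf_comp2 wl_vc ?fa_id in E3; last by boundary.
have /= <- := tn_nat2 (mu T) l.
rewrite comp2_assoc comp2_id act_mult -comp2_id -comp2_assoc -E3 -E2.
have E4 := f_equal (fun c => c ⋆ \1 (map1 T (map1 T a))) (um2_multE f).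
rewrite /= wr_vc in E4; last by boundary.
rewrite -!comp2_assoc !comp2_id Na in E4.
rewrite -vcA -?E4 //; by boundary; rewrite ?limit_saX -?comp1_assoc ?Tsa.
Qed.

Definition limit_alg : TAlg T := MkTAlg limit_act_unit limit_act_mult.

Definition limit_proj1 : SMap limit_alg A :=
  exist (fun j => is_strict j) (@strict_map K T limit_alg A a (esym sa)) erefl.

Definition limit_proj2 : SMap limit_alg B :=
  exist (fun j => is_strict j) (@strict_map K T limit_alg B b (esym limit_sb)) erefl.

Lemma limit_cell_eq : (l ⋆ \1 (act limit_alg)) • um2 (TMap_comp f (smap limit_proj1)) =
  um2 (smap limit_proj2) • (\1 (act B) ⋆ map2 T l).
Proof.
rewrite um2_comp_strictr //= sl vc1l //.
by boundary.
Qed.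

Definition limit_cell : AlgCell limit_alg B :=
  @MkCell K T limit_alg B (TMap_comp f (smap limit_proj1)) (smap limit_proj2) l dl cl
    limit_cell_eq.

(** The 1-cell [h] is induced in K. Its structure 2-cell [r] is induced by those of [a'] and [b'],
    and the axioms for [r] hold because they hold on both projections. *)
Lemma limit_cell_ex (X : TAlg T) (a' : TMap X A) (l' : AlgCell X B) :
  adom l' = TMap_comp f a' -> (inv -> invertible (ucell l')) ->
  exists h : TMap X limit_alg, TMap_comp (smap limit_proj1) h = a' /\
    AlgCell_comp2 limit_cell (AlgCell_id h) = l'.
Proof.
move=> el il; pose b' := acod l'.
have dl' : dom (ucell l') = f ∘ um a' by rewrite ucell_dom el.
have cl' : cod (ucell l') = um b' by rewrite ucell_cod.
have [h [ha hl]] := lim_ex1 HL dl' il.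
have hb : b ∘ h = um b' by rewrite -cl' -hl; boundary.
have sah : a ∘ (s ∘ map1 T h) = act A ∘ map1 T (um a').
  by rewrite limit_saX -tf_comp1 ha.
have sbh : b ∘ (s ∘ map1 T h) = act B ∘ map1 T (um b').
  by rewrite comp1_assoc limit_sb -comp1_assoc -tf_comp1 hb.
have iw : invertible (um2 f ⋆ \1 (map1 T (um a'))).
  by apply: invertible_comp2; [exact: um2_inv | exact: invertible_id].
have hax : a ∘ (h ∘ act X) = um a' ∘ act X by rewrite comp1_assoc ha.
have hbx : b ∘ (h ∘ act X) = um b' ∘ act X by rewrite comp1_assoc hb.
have E : (l ⋆ \1 (h ∘ act X)) • (\1 (um f) ⋆ um2 a') =
         um2 b' • (l ⋆ \1 (s ∘ map1 T h)).
  (* Composed with [um2 f ⋆ T a'], the equation becomes the algebra condition on [l'], up to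
     [sl]. *)
  apply: (invertible_epi iw); [by boundary; rewrite ?sah..|].
  have El := ucell_eqE l'.
  rewrite el um2_compE -/b' -{1}hl in El.
  rewrite -comp2_assoc comp2_id in El.
  rewrite -vcA; [|by boundary..].
  rewrite El -vcA; [|by boundary; rewrite ?sah..].
  f_equal; have E1 := f_equal (fun c => c ⋆ \1 (map1 T h)) sl.
  rewrite wr_vc in E1; last by boundary.
  rewrite -!comp2_assoc !comp2_id -tf_comp1 ha in E1.
  by rewrite E1 -hl tf_comp2 fa_id.
have dp : dom (um2 a') = a ∘ (s ∘ map1 T h) by rewrite um2_dom sah.
have cp : cod (um2 a') = a ∘ (h ∘ act X) by rewrite um2_cod hax.
have dq : dom (um2 b') = b ∘ (s ∘ map1 T h) by rewrite um2_dom sbh.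
have cq : cod (um2 b') = b ∘ (h ∘ act X) by rewrite um2_cod hbx.
have [r [dr cr ra rb]] := lim_ex2 HL dp cp dq cq E.
have ir : invertible r.
  by apply: (limit_invertible HL); rewrite ?ra ?rb; apply: um2_inv.
have ru : r ⋆ \1 (eta T X) = \1 h.
{ have := tn_nat1 (eta T) h; rewrite /= => Nh.
  apply: (lim_uniq2 HL).
  - by boundary; rewrite -Nh comp1_assoc limit_act_unit comp1_1l.
  - by boundary; rewrite act_unit comp1_1r.
  - by rewrite comp2_assoc ra um2_unit comp2_id ha.
  - by rewrite comp2_assoc rb um2_unit comp2_id hb. }
have rTa : \1 (map1 T a) ⋆ map2 T r = map2 T (um2 a') by rewrite -fa_id -tf_comp2 ra.
have rTb : \1 (map1 T b) ⋆ map2 T r = map2 T (um2 b') by rewrite -fa_id -tf_comp2 rb.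
have rm : (r ⋆ \1 (map1 T (act X))) • (\1 s ⋆ map2 T r) = r ⋆ \1 (mu T X).
{ have Nh := tn_nat1 (mu T) h; rewrite /= in Nh.
  have mt : cod (\1 s ⋆ map2 T r) = dom (r ⋆ \1 (map1 T (act X))) by boundary.
  apply: (lim_uniq2 HL).
  - by rewrite dom_vc //; boundary; rewrite -Nh !comp1_assoc limit_act_mult.
  - by rewrite cod_vc //; boundary; rewrite act_mult.
  - rewrite wl_vc // !comp2_assoc ra comp2_id sa -comp2_id -comp2_assoc.
    by rewrite rTa um2_multE.
  - rewrite wl_vc // !comp2_assoc rb comp2_id limit_sb -comp2_id -comp2_assoc.
    by rewrite rTb um2_multE. }
have rm' : Cmp (r ⋆ \1 (map1 T (act X))) (\1 s ⋆ map2 T r) (r ⋆ \1 (mu T X)).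
  by rewrite -rm; apply: Cmp_vc; boundary.
pose h' : TMap X limit_alg := @MkTMap K T X limit_alg h r dr cr ir ru rm'.
have ha' : TMap_comp (smap limit_proj1) h' = a'.
  by apply: TMap_eq => //; rewrite um2_comp_strictl.
have hb' : TMap_comp (smap limit_proj2) h' = b'.
  by apply: TMap_eq => //; rewrite um2_comp_strictl.
exists h'; split=> //; apply: AlgCell_eq => //.
by rewrite [LHS](esym (TMap_compA f (smap limit_proj1) h')) ha' -el.
Qed.

Lemma limit_cell_uniq (X : TAlg T) (h h' : TMap X limit_alg) :
  TMap_comp (smap limit_proj1) h = TMap_comp (smap limit_proj1) h' ->
  AlgCell_comp2 limit_cell (AlgCell_id h) = AlgCell_comp2 limit_cell (AlgCell_id h') ->
  h = h'.
Proof.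
move=> ea el.
have eb := f_equal (@acod _ _ _ _) el; rewrite /= in eb.
have ea0 := f_equal (@um _ _ _ _) ea; have el0 := f_equal (@ucell _ _ _ _) el.
have eh : um h = um h' by apply: (lim_uniq1 HL).
apply: TMap_eq => //; apply: (lim_uniq2 HL).
- by have /= -> := um2_dom h; have /= -> := um2_dom h'; rewrite eh.
- by have /= -> := um2_cod h; have /= -> := um2_cod h'; rewrite eh.
- by have := f_equal (@um2 _ _ _ _) ea; rewrite !um2_comp_strictl.
- by have := f_equal (@um2 _ _ _ _) eb; rewrite !um2_comp_strictl.
Qed.

Lemma limit_cell_strict (X : TAlg T) (h : TMap X limit_alg) :
  is_strict (TMap_comp (smap limit_proj1) h) ->
  is_strict (TMap_comp (smap limit_proj2) h) -> is_strict h.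
Proof.
move=> Ha Hb.
have dh := um2_dom h; have ch := um2_cod h; rewrite /= in dh ch.
have ea : a ∘ (um h ∘ act X) = a ∘ (s ∘ map1 T h).
  by have := is_strictP Ha; rewrite /= limit_saX comp1_assoc -tf_comp1.
have eb : b ∘ (um h ∘ act X) = b ∘ (s ∘ map1 T h).
  rewrite [b ∘ (s ∘ _)]comp1_assoc limit_sb -[RHS]comp1_assoc -tf_comp1 comp1_assoc.
  by have /= -> := is_strictP Hb.
have ra : \1 a ⋆ um2 h = \1 (a ∘ (s ∘ map1 T h)).
  have := Ha; rewrite /is_strict um2_comp_strictl //= => ->.
  by rewrite limit_saX -tf_comp1.
have rb : \1 b ⋆ um2 h = \1 (b ∘ (s ∘ map1 T h)).
  have := Hb; rewrite /is_strict um2_comp_strictl //= => ->.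
  by rewrite [b ∘ (s ∘ _)]comp1_assoc limit_sb -comp1_assoc -tf_comp1.
(* Both projections of [um2 h] are identities, so naturality of [l] shows that [l] agrees on the
   domain and codomain of [um2 h]; hence these 1-cells coincide. *)
have E := limit_nat (um2 h) dl cl.
rewrite ra rb dh ch comp2_id in E.
have es : um h ∘ act X = s ∘ map1 T h.
  apply: (lim_uniq1 HL) => //.
  by move: E; rewrite vc1r ?vc1l //; boundary; rewrite ?ea.
apply: (lim_uniq2 HL); rewrite ?dom_id ?cod_id ?dh ?ch ?comp2_id //.
Qed.

End Lifting.

Lemma alg_limit_exists (inv : Prop) (K : TwoCat) (T : TwoMonad K) (A B : TAlg T)
    (f : TMap A B) (L : K) (a : hom L A) (b : hom L B) (l : cell L B) :
  is_limit inv (um f) a b l ->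
  exists (M : TAlg T) (a : SMap M A) (b : SMap M B) (l : AlgCell M B),
    is_alg_limit inv f a b l.
Proof.
move=> HL; have [s [sa sl]] := limit_act_ex HL.
exists (limit_alg HL sa sl), (limit_proj1 HL sa sl), (limit_proj2 HL sa sl),
  (limit_cell HL sa sl); split=> //.
- exact: lim_inv HL.
- exact: limit_cell_ex.
- exact: limit_cell_uniq.
- exact: lim_uniq1 HL.
- exact: limit_cell_strict.
Qed.

(** * Universal arrows and 2-adjunctions *)

Section UniversalArrows.
Variables (K L : TwoCat) (G : TwoFunctor L K) (Q : K -> L).
Variable z : forall X : K, hom X (G (Q X)).
Hypothesis z_univ : forall (X : K) (Y : L) (al : cell X (G Y)),
  exists! be : cell (Q X) Y, map2 G be ⋆ \1 (z X) = al.

Definition lift2 (X : K) (Y : L) (al : cell X (G Y)) : cell (Q X) Y :=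
  proj1_sig (constructive_indefinite_description _ (z_univ al)).

Lemma lift2K (X : K) (Y : L) (al : cell X (G Y)) : map2 G (lift2 al) ⋆ \1 (z X) = al.
Proof. by rewrite /lift2; case: constructive_indefinite_description => be []. Qed.

Lemma univ_ext2 (X : K) (Y : L) (be be' : cell (Q X) Y) :
  map2 G be ⋆ \1 (z X) = map2 G be' ⋆ \1 (z X) -> be = be'.
Proof. by have [b [_ U]] := z_univ (map2 G be' ⋆ \1 (z X)) => e; rewrite -(U be) ?(U be'). Qed.

Lemma univ_ext1 (X : K) (Y : L) (k k' : hom (Q X) Y) :
  map1 G k ∘ z X = map1 G k' ∘ z X -> k = k'.
Proof.
move=> e; rewrite -(dom_id k) -(dom_id k'); f_equal.
by apply: univ_ext2; rewrite !fa_id !comp2_id e.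
Qed.

(** Universality is assumed for 2-cells alone; the one-dimensional property is its case of identity
    2-cells. *)
Definition lift1 (X : K) (Y : L) (f : hom X (G Y)) : hom (Q X) Y := dom (lift2 (\1 f)).

Lemma lift1K (X : K) (Y : L) (f : hom X (G Y)) : map1 G (lift1 f) ∘ z X = f.
Proof. by have := f_equal dom (lift2K (\1 f)); rewrite dom_comp2 dom_fa !dom_id. Qed.

Lemma dom_lift2 (X : K) (Y : L) (al : cell X (G Y)) : dom (lift2 al) = lift1 (dom al).
Proof.
apply: univ_ext1; rewrite lift1K.
by have := f_equal dom (lift2K al); rewrite dom_comp2 dom_fa dom_id.
Qed.

Lemma cod_lift2 (X : K) (Y : L) (al : cell X (G Y)) : cod (lift2 al) = lift1 (cod al).
Proof.
apply: univ_ext1; rewrite lift1K.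
by have := f_equal cod (lift2K al); rewrite cod_comp2 cod_fa cod_id.
Qed.

Definition univ_hom (X Y : K) : Functor (hom X Y) (hom (Q X) (Q Y)).
Proof.
refine (@MkFunctor (hom X Y) (hom (Q X) (Q Y)) (fun f => lift1 (z Y ∘ f))
  (fun al => lift2 (\1 (z Y) ⋆ al)) _ _ _ _).
- by move=> al; rewrite dom_lift2 dom_comp2 dom_id.
- by move=> al; rewrite cod_lift2 cod_comp2 cod_id.
- by move=> f; apply: univ_ext2; rewrite lift2K fa_id !comp2_id lift1K.
- move=> g f c H; have e := Cmp_match H.
  have m : cod (lift2 (\1 (z Y) ⋆ f)) = dom (lift2 (\1 (z Y) ⋆ g)).
    by rewrite cod_lift2 dom_lift2 cod_comp2 dom_comp2 e cod_id dom_id.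
  have -> : lift2 (\1 (z Y) ⋆ c) = lift2 (\1 (z Y) ⋆ g) • lift2 (\1 (z Y) ⋆ f).
    apply: univ_ext2; rewrite fa_vc // wr_vc ?lift2K; last by rewrite cod_fa dom_fa m.
    by rewrite -(vcE H) wl_vc.
  exact: Cmp_vc.
Defined.

Definition univ_functor : TwoFunctor K L.
Proof.
refine (@MkTwoFunctor K L Q univ_hom _ _ _) => /=.
- by move=> A; apply: univ_ext1; rewrite lift1K tf_one comp1_1l comp1_1r.
- move=> A B C g f; apply: univ_ext1.
  by rewrite lift1K tf_comp1 -comp1_assoc lift1K !comp1_assoc lift1K.
- move=> A B C b a; apply: univ_ext2.
  by rewrite lift2K tf_comp2 -comp2_assoc lift2K !comp2_assoc lift2K.
Defined.

Definition univ_unit : TwoNat (id2F K) (comp2F G univ_functor).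
Proof.
refine (@MkTwoNat K K (id2F K) (comp2F G univ_functor) z _ _) => /=.
- by move=> A B f; rewrite lift1K.
- by move=> A B a; rewrite lift2K.
Defined.

Definition univ_counit : TwoNat (comp2F univ_functor G) (id2F L).
Proof.
refine (@MkTwoNat L L (comp2F univ_functor G) (id2F L) (fun Y => lift1 (one (G Y))) _ _) => /=.
- move=> A B f; apply: univ_ext1; rewrite !tf_comp1 -!comp1_assoc !lift1K.
  by rewrite comp1_assoc lift1K comp1_1l comp1_1r.
- move=> A B a; apply: univ_ext2; rewrite !tf_comp2 -!comp2_assoc !lift2K.
  by rewrite !fa_id comp2_assoc !comp2_id !lift1K comp2_1l comp2_1r.
Defined.

Definition univ_adj : TwoAdj univ_functor G.
Proof.
refine (@MkTwoAdj K L univ_functor G univ_unit univ_counit _ _) => /=.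
- move=> X; apply: univ_ext1; rewrite tf_comp1 -comp1_assoc lift1K.
  by rewrite comp1_assoc lift1K tf_one.
- by move=> Y; rewrite lift1K.
Defined.

End UniversalArrows.

Section Adjunction.
Variables (K L : TwoCat) (F : TwoFunctor K L) (G : TwoFunctor L K) (adj : TwoAdj F G).

Lemma adj_lift (X : K) (Y : L) (f : hom X (G Y)) :
  exists k : hom (F X) Y, map1 G k ∘ adj_unit adj X = f.
Proof.
exists (adj_counit adj Y ∘ map1 F f); rewrite tf_comp1 -comp1_assoc.
have /= <- := tn_nat1 (adj_unit adj) f.
by rewrite comp1_assoc adj_triangle2 comp1_1l.
Qed.

Lemma adj_ext (X : K) (Y : L) (k k' : hom (F X) Y) :
  map1 G k ∘ adj_unit adj X = map1 G k' ∘ adj_unit adj X -> k = k'.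
Proof.
have E (h : hom (F X) Y) :
    h = adj_counit adj Y ∘ map1 F (map1 G h ∘ adj_unit adj X).
  rewrite tf_comp1 comp1_assoc.
  have /= -> := tn_nat1 (adj_counit adj) h.
  by rewrite -comp1_assoc adj_triangle1 comp1_1r.
by move=> e; rewrite (E k) (E k') e.
Qed.

End Adjunction.

(** * The conclusions (C) and (D) *)

Section Consequences.
Variables (K : TwoCat) (T : TwoMonad K).

(** The extension of [h] along [eta] is [act X ∘ T h]. *)
Lemma free_strict_ex (C : K) (X : TAlg T) (h : hom C X) :
  exists s : SMap (free T C) X, um (smap s) ∘ eta T C = h.
Proof.
have e : act X ∘ map1 T (act X ∘ map1 T h) = act X ∘ map1 T h ∘ act (free T C).
  rewrite tf_comp1 comp1_assoc -act_mult -!comp1_assoc.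
  by have /= -> := tn_nat1 (mu T) h.
exists (exist (fun j => is_strict j) (@strict_map K T (free T C) X _ e) erefl) => /=.
by rewrite -comp1_assoc; have /= <- := tn_nat1 (eta T) h; rewrite comp1_assoc act_unit comp1_1l.
Qed.

Lemma SMap_eq (X Y : TAlg T) (j k : SMap X Y) : smap j = smap k -> j = k.
Proof. by move=> e; apply: eq_sig_hprop => // *; apply: proof_irrelevance. Qed.

Definition smap_comp (X Y Z : TAlg T) (k : SMap Y Z) (j : SMap X Y) : SMap X Z :=
  exist (fun f => is_strict f) _ (TMap_comp_strict (proj2_sig k) (proj2_sig j)).

Hypothesis HP : admits_pseudolimits_of_1cells K.

Lemma alg_pseudolimit (A B : TAlg T) (f : TMap A B) :
  exists (M : TAlg T) (a : SMap M A) (b : SMap M B) (l : AlgCell M B),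
    is_alg_limit True f a b l.
Proof.
have [L [a [b [l /pseudolimit_limit Hl]]]] := HP (um f).
exact: alg_limit_exists Hl.
Qed.

Lemma classifier_adj_surj_equiv (Q : Classifier T) (Y : Alg T) :
  exists Th : arr (@hom (Alg T) (Q Y) (Q Y)),
    is_adj_surj_equiv (zeta Q Y) (map1 (incl T) (delta Q Y)) Th.
Proof.
have [M [a [b [l Hl]]]] := alg_pseudolimit (zeta Q Y : TMap _ _).
(* The identity of [zeta], read as a 2-cell from [zeta ∘ 1] to [zeta], is classified by [h]. *)
have [||h [ha hl]] := alim_ex Hl (X := Y) (a' := TMap_one Y)
  (l' := AlgCell_id (zeta Q Y : TMap _ _)).
1: by rewrite TMap_comp1r.
1: by move=> _; apply: invertible_id.
have hb : TMap_comp (smap b) h = zeta Q Y.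
  by have := f_equal (@acod _ _ _ _) hl; rewrite /= (alim_cod Hl).
have [k kh] := adj_lift (cl_adj Q) (h : @hom (Alg T) Y (incl T M)).
have kb : smap_comp b k = (one (Q Y) : @hom (Algs T) (Q Y) (Q Y)).
  apply: (adj_ext (adj := cl_adj Q)).
  rewrite tf_one comp1_1l [RHS](esym hb) -kh; exact: esym (TMap_compA _ _ _).
have ka : smap_comp a k = delta Q Y.
  apply: (adj_ext (adj := cl_adj Q)).
  rewrite (adj_triangle2 (cl_adj Q) Y) [RHS](esym ha) -kh; exact: esym (TMap_compA _ _ _).
have kb' : TMap_comp (smap b) (smap k) = TMap_one (Q Y) by have := f_equal (@proj1_sig _ _) kb.
have ka' : TMap_comp (smap a) (smap k) = smap (delta Q Y) by have := f_equal (@proj1_sig _ _) ka.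
(* Since [a k = delta] and [b k = 1], this is a 2-cell from [zeta ∘ delta] to the identity. Along
   [zeta] it restricts to [l] along [h], the identity of [zeta], so the equivalence is adjoint. *)
exists (AlgCell_comp2 l (AlgCell_id (smap k))); split; first split.
- exact: (adj_triangle2 (cl_adj Q) Y).
- split; first by rewrite /= (alim_dom Hl) -TMap_compA ka'.
  split; first by rewrite /= (alim_cod Hl) kb'.
  apply: AlgCell_invertible => /=.
  by apply: invertible_comp2; [exact: (alim_inv Hl I) | exact: invertible_id].
- have kh' : TMap_comp (smap k) (zeta Q Y) = h := kh.
  have hl1 := f_equal (@adom _ _ _ _) hl; have hl2 := f_equal (@acod _ _ _ _) hl.
  have hl3 := f_equal (@ucell _ _ _ _) hl; rewrite /= in hl1 hl2 hl3.
  apply: AlgCell_eq.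
  + by rewrite [LHS](esym (TMap_compA _ _ _)) kh'.
  + by rewrite [LHS](esym (TMap_compA _ _ _)) kh'.
  + by rewrite /= -comp2_assoc comp2_id -hl3 -kh'.
Qed.


Lemma Sq_eq (C C' D D' : K) (phi : hom C C') (psi : hom D D') (m m' : Sq phi psi) :
  sqR m = sqR m' -> sqS m = sqS m' -> m = m'.
Proof.
case: m => R S e; case: m' => R' S' e' /= eR eS; subst R' S'.
by f_equal; apply: proof_irrelevance.
Qed.

(** Paired with the identity of [TC], both strict maps become morphisms of T-Alg^{2,s} to the same
    T-map, with equal restrictions. *)
Lemma up_ext (C C' : K) (phi : hom C C') (u : UnivPseudo T phi) (Y : TAlg T)
  (j k : SMap (up_alg u) Y) :
  TMap_comp (smap j) (up_map u) = TMap_comp (smap k) (up_map u) ->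
  um (smap j) ∘ up_kappa u = um (smap k) ∘ up_kappa u -> j = k.
Proof.
move=> e ek.
pose one_free : SMap (free T C) (free T C) := exist (fun f => is_strict f) (TMap_one _) erefl.
pose g := TMap_comp (smap k) (up_map u).
pose mj : TSq (up_map u) g :=
  @MkTSq K T _ _ _ _ (up_map u) g one_free j (eq_trans (TMap_comp1r _) (esym e)).
pose mk : TSq (up_map u) g :=
  @MkTSq K T _ _ _ _ (up_map u) g one_free k (TMap_comp1r _).
suff : mj = mk by move/(f_equal (@tsqK _ _ _ _ _ _ _ _)).
rewrite -(up_resK mj) -(up_resK mk); f_equal.
exact: Sq_eq.
Qed.

(** The first component of the induced morphism is strict and fixes [eta], so it is the identity of
    [TC]. *)
Lemma up_lift (C C' : K) (phi : hom C C') (u : UnivPseudo T phi) (Y : TAlg T)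
  (f : TMap (free T C) Y) (S : hom C' Y) : um f ∘ eta T C = S ∘ phi ->
  exists k : SMap (up_alg u) Y,
    TMap_comp (smap k) (up_map u) = f /\ um (smap k) ∘ up_kappa u = S.
Proof.
move=> e; pose m := up_bar u (MkSq e : Sq phi (um f)).
have mK : sq_comp (forget_sq m) (MkSq (up_sq u)) = MkSq e := up_barK u _.
exists (tsqK m); split; last by have := f_equal (@sqS _ _ _ _ _ _ _) mK.
have eJ : smap (tsqJ m) = TMap_one (free T C).
  apply: free_strict_ext; [exact: proj2_sig | exact: TMap_one_strict |].
  by have := f_equal (@sqR _ _ _ _ _ _ _) mK; rewrite /= comp1_1l.
by rewrite -tsq_eq eJ TMap_comp1r.
Qed.

Lemma Delta_surjective_equivalence (C C' : K) (phi : hom C C') (u : UnivPseudo T phi) :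
  @surjective_equivalence (Algs T) (free T C') (up_alg u) (Delta u).
Proof.
(* The section of [Delta] is the strict extension of [up_kappa u]. *)
have [sec secE] := free_strict_ex (up_kappa u).
have DK := up_barK u (eta_sq T phi); pose m := up_bar u (eta_sq T phi); rewrite -/m in DK.
have Dkappa : um (smap (Delta u)) ∘ up_kappa u = eta T C'.
  by have := f_equal (@sqS _ _ _ _ _ _ _) DK.
have DJ : smap (tsqJ m) = TMap_one (free T C).
  apply: free_strict_ext; [exact: proj2_sig | exact: TMap_one_strict |].
  by have := f_equal (@sqR _ _ _ _ _ _ _) DK; rewrite /= comp1_1l.
have Dmap : TMap_comp (smap (Delta u)) (up_map u) = free_map T phi.
  by have := tsq_eq m; rewrite DJ TMap_comp1r => ->.
have Dsec : TMap_comp (smap (Delta u)) (smap sec) = TMap_one (free T C').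
  apply: free_strict_ext; [exact: TMap_comp_strict (proj2_sig _) (proj2_sig _) | exact: TMap_one_strict |].
  by rewrite /= -comp1_assoc secE Dkappa comp1_1l.
pose s := TMap_comp (smap sec) (free_map T phi).
have ss : is_strict s by apply: TMap_comp_strict; first exact: proj2_sig.
have Ne := tn_nat1 (eta T) phi; rewrite /= in Ne.
have es : um s ∘ eta T C = um (up_map u) ∘ eta T C.
  by rewrite /= -comp1_assoc -Ne comp1_assoc secE up_sq.
have [al [da ca ia ea]] := strictification_cell ss es.
have [M [a [b [l Hl]]]] := alg_pseudolimit (TMap_one (up_alg u)).
(* [h] classifies the isomorphism from [s] to the universal pseudomorphism; [h0] below classifies
   the identity of [sec]. *)
have [||h [ha hl]] := alim_ex Hl (X := free T C) (a' := s) (l' := al).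
1: by rewrite TMap_comp1l.
1: by [].
have hb : TMap_comp (smap b) h = up_map u.
  by have := f_equal (@acod _ _ _ _) hl; rewrite /= (alim_cod Hl) ca.
have [||h0 [ha0 hl0]] := alim_ex Hl (a' := smap sec) (l' := AlgCell_id (smap sec)).
1: by rewrite TMap_comp1l.
1: by move=> _; apply: invertible_id.
have ha0' := f_equal (@um _ _ _ _) ha0; rewrite /= in ha0'.
have hb0 : um (smap b) ∘ um h0 = um (smap sec).
  by have := f_equal (@um _ _ _ _) (f_equal (@acod _ _ _ _) hl0); rewrite /= (alim_cod Hl).
(* The square holds because [al] restricts to an identity along [eta]; it makes [h] and [h0 ∘ eta]
   induce a strict map [k] into [M]. *)
have hS : um h ∘ eta T C = um h0 ∘ eta T C' ∘ phi.
{ have ha' := f_equal (@um _ _ _ _) ha.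
  have hl' := f_equal (@ucell _ _ _ _) hl; have hl0' := f_equal (@ucell _ _ _ _) hl0.
  rewrite /= in ha' hl' hl0'.
  apply: (alim_mono Hl).
  - by rewrite !comp1_assoc ha' ha0' -[LHS]comp1_assoc -Ne comp1_assoc.
  - rewrite -!comp2_id !comp2_assoc hl' hl0' ea !comp2_id secE.
    by rewrite up_sq. }
have [k [kmap kkappa]] := up_lift u hS.
have ka : smap_comp a k = smap_comp sec (Delta u).
{ apply: up_ext => /=.
  - by rewrite -!TMap_compA kmap Dmap ha.
  - by rewrite -!comp1_assoc kkappa Dkappa comp1_assoc ha0' secE. }
have kb : smap_comp b k = exist (fun f => is_strict f) (TMap_one _) (TMap_one_strict _).
{ apply: up_ext => /=.
  - by rewrite -!TMap_compA kmap hb TMap_comp1l.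
  - by rewrite -!comp1_assoc kkappa comp1_assoc hb0 secE comp1_1l. }
have ka' : TMap_comp (smap a) (smap k) = TMap_comp (smap sec) (smap (Delta u)).
  by have := f_equal (@proj1_sig _ _) ka.
have kb' : TMap_comp (smap b) (smap k) = TMap_one _ by have := f_equal (@proj1_sig _ _) kb.
pose Th : AlgCell (up_alg u) (up_alg u) := AlgCell_comp2 l (AlgCell_id (smap k)).
have dTh : adom Th = TMap_comp (smap sec) (smap (Delta u)).
  by rewrite /= (alim_dom Hl) TMap_comp1l ka'.
have cTh : acod Th = TMap_one (up_alg u) by rewrite /= (alim_cod Hl) kb'.
have [i [i1 i2]] : @invertible (Alg_hom _ _) Th.
  apply: AlgCell_invertible; apply: invertible_comp2; last exact: invertible_id.
  exact: (alim_inv Hl I).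
have st1 : is_strict (adom Th).
  by rewrite dTh; apply: TMap_comp_strict; apply: proj2_sig.
have st2 : is_strict (acod Th) by rewrite cTh.
(* The inverse in T-Alg has strict boundaries, hence lies in T-Alg_s. *)
have di : adom i = acod Th by exact: esym (Cmp_match i1).
have ci : acod i = adom Th by exact: Cmp_match i2.
have sti1 : is_strict (adom i) by rewrite di.
have sti2 : is_strict (acod i) by rewrite ci.
exists sec.
exists (exist (fun c => is_strict (adom c) /\ is_strict (acod c)) Th (conj st1 st2)).
split; first exact: SMap_eq.
split; first exact: SMap_eq.
split; first exact: SMap_eq.
exists (exist (fun c => is_strict (adom c) /\ is_strict (acod c)) i (conj sti1 sti2)).
by split; apply/lf_Cmp.
Qed.

End Consequences.

(** * Constructing universal pseudomorphisms and classifiers *)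

Section ClassifierToUniversal.
Variables (K : TwoCat) (T : TwoMonad K).

Lemma TSq_eq (X Y X' Y' : TAlg T) (f : TMap X Y) (g : TMap X' Y') (m m' : TSq f g) :
  tsqJ m = tsqJ m' -> tsqK m = tsqK m' -> m = m'.
Proof.
case: m => R S e; case: m' => R' S' e' /= eR eS; subst R' S'.
by f_equal; apply: proof_irrelevance.
Qed.

(** Unique existence yields the inverse function [up_bar] by description. *)
Lemma UnivPseudo_exists (C C' : K) (phi : hom C C') (P : TAlg T)
    (m : TMap (free T C) P) (kap : hom C' P) (sq : um m ∘ eta T C = kap ∘ phi) :
  (forall (X Y : TAlg T) (f : TMap X Y) (s : Sq phi (um f)),
    exists! t : TSq m f, sq_comp (forget_sq t) (MkSq sq) = s) ->
  inhabited (UnivPseudo T phi).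
Proof.
move=> H.
pose bar X Y (f : TMap X Y) (s : Sq phi (um f)) : TSq m f :=
  proj1_sig (constructive_indefinite_description _ (H X Y f s)).
have barK X Y (f : TMap X Y) (s : Sq phi (um f)) :
    sq_comp (forget_sq (bar X Y f s)) (MkSq sq) = s.
  by rewrite /bar; case: constructive_indefinite_description => t [].
split; refine (@MkUnivPseudo K T C C' phi P m kap sq bar barK _).
move=> X Y f t; have [t' [_ U]] := H X Y f (sq_comp (forget_sq t) (MkSq sq)).
exact: eq_trans (esym (U _ (barK _ _ _ _))) (U t erefl).
Qed.

Lemma classifier_universal (H3 : admits_pushouts (Algs T)) :
  admits_classifier T -> admits_universal_pseudomorphisms T.
Proof.
move=> [Q] C C' phi.
pose z : TMap (free T C) (Q (free T C)) := zeta Q (free T C).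
have [e ee] := free_strict_ex (um z ∘ eta T C).
pose t : SMap (free T C) (free T C') := exist (fun f => is_strict f) (free_map T phi) erefl.
have [P [p [q [pq [PO _]]]]] := H3 (free T C) (Q (free T C)) (free T C') e t.
pose p' : SMap (Q (free T C)) P := p; pose q' : SMap (free T C') P := q.
have pq' : TMap_comp (smap p') (smap e) = TMap_comp (smap q') (smap t).
  by have := f_equal (@proj1_sig _ _) pq.
have Ne := tn_nat1 (eta T) phi; rewrite /= in Ne.
(* The universal pseudomorphism is [p' ∘ zeta], with [kappa] given by [q' ∘ eta]. *)
have sq : um (TMap_comp (smap p') z) ∘ eta T C = (um (smap q') ∘ eta T C') ∘ phi.
  rewrite /= -comp1_assoc -ee comp1_assoc.
  have := f_equal (@um _ _ _ _) pq'; rewrite /= => ->.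
  by rewrite -!comp1_assoc -Ne.
apply: (UnivPseudo_exists (sq := sq)) => X Y f s.
have [J EJ] := free_strict_ex (sqR s); have [S' ES] := free_strict_ex (sqS s).
have [v vE] := adj_lift (cl_adj Q) (TMap_comp f (smap J) : @hom (Alg T) (free T C) (incl T Y)).
have vz : TMap_comp (smap v) z = TMap_comp f (smap J) := vE.
(* The strict map [v] classifying [f ∘ J] and the extension [S'] form a cocone: on [eta] this is the
   equation of the square [s]. *)
have ve : smap_comp v e = smap_comp S' t.
  apply: SMap_eq; apply: free_strict_ext; [exact: proj2_sig | exact: proj2_sig |].
  rewrite /= -comp1_assoc ee comp1_assoc.
  have := f_equal (@um _ _ _ _) vz; rewrite /= => ->.
  by rewrite -!comp1_assoc EJ sq_eq -Ne comp1_assoc ES.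
have [w [[wp wq] _]] := PO Y v S' ve.
have wp' : TMap_comp (smap w) (smap p') = smap v by have := f_equal (@proj1_sig _ _) wp.
have wq' : TMap_comp (smap w) (smap q') = smap S' by have := f_equal (@proj1_sig _ _) wq.
have we : TMap_comp f (smap J) = TMap_comp (smap w) (TMap_comp (smap p') z).
  by rewrite TMap_compA wp' vz.
exists (@MkTSq K T _ _ _ _ _ _ J w we); split.
  apply: Sq_eq => //=.
  by rewrite comp1_assoc; have := f_equal (@um _ _ _ _) wq'; rewrite /= => ->.
move=> t' Et'.
have ER := f_equal (@sqR _ _ _ _ _ _ _) Et'; have EK := f_equal (@sqS _ _ _ _ _ _ _) Et'.
rewrite /= in ER EK.
have JJ : smap J = smap (tsqJ t').
  by apply: free_strict_ext; [exact: proj2_sig | exact: proj2_sig | rewrite EJ ER].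
apply: TSq_eq => /=; first exact: SMap_eq.
(* The second component of [t'] satisfies the equations that determine [w], tested on [zeta] and on
   [eta]. *)
have [w' [_ U]] := PO Y v S' ve.
rewrite -(U w) // -(U (tsqK t')) //; split.
- apply: (adj_ext (adj := cl_adj Q)).
  rewrite vE JJ tsq_eq.
  exact: esym (TMap_compA _ _ _).
- apply: SMap_eq; apply: free_strict_ext; [exact: proj2_sig | exact: proj2_sig |].
  by rewrite ES -EK /= comp1_assoc.
Qed.

End ClassifierToUniversal.

(** * From universal pseudomorphisms to a classifier *)

Section UniversalToClassifier.
Variables (K : TwoCat) (T : TwoMonad K).

Definition act_map (X : TAlg T) : TMap (free T X) X :=
  @strict_map K T (free T X) X (act X) (esym (act_mult X)).

(** [act X] is split by [eta], and [T (act X)] by [T eta]; this recovers the 1-cell and the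
    structure 2-cell. *)
Lemma act_map_epi (X Y : TAlg T) (f g : TMap X Y) :
  TMap_comp f (act_map X) = TMap_comp g (act_map X) -> f = g.
Proof.
move=> e; have e1 := f_equal (@um _ _ _ _) e; have e2 := f_equal (@um2 _ _ _ _) e.
rewrite !um2_comp_strictr // in e2; rewrite /= in e1 e2.
apply: TMap_eq.
- have := f_equal (fun h => h ∘ eta T X) e1.
  by rewrite -!comp1_assoc act_unit !comp1_1r.
- have := f_equal (fun c => c ⋆ \1 (map1 T (eta T X))) e2.
  by rewrite -!comp2_assoc !comp2_id -tf_comp1 act_unit tf_one comp2_1r => ->; rewrite comp2_1r.
Qed.

(* [act X] is split by [eta], and T preserves the splitting; the 2-cell of the
   factorization is [um2 g ⋆ \1 (T eta)]. *)
Lemma act_map_descent (X Y : TAlg T) (g : TMap (free T X) Y) :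
  TMap_comp g (mu_map T X) = TMap_comp g (free_map T (act X)) ->
  exists f : TMap X Y, TMap_comp f (act_map X) = g.
Proof.
move=> e; have e1 := f_equal (@um _ _ _ _) e; have e2 := f_equal (@um2 _ _ _ _) e.
rewrite !um2_comp_strictr // in e2; rewrite /= in e1 e2.
have /= dg := um2_dom g; have /= cg := um2_cod g.
pose f := um g ∘ eta T X.
have Nx := tn_nat1 (eta T) (act X); rewrite /= in Nx.
have fx : f ∘ act X = um g.
  by rewrite /f -comp1_assoc Nx comp1_assoc -e1 -comp1_assoc mu_etar comp1_1r.
pose c : cell (T X) Y := um2 g ⋆ \1 (map1 T (eta T X)).
(* The 2-cell part of the hypothesis makes [um2 g] factor through [T (act X)]. *)
have cTx : c ⋆ \1 (map1 T (act X)) = um2 g.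
  rewrite /c -comp2_assoc comp2_id -tf_comp1 Nx tf_comp1 -comp2_id comp2_assoc -e2.
  by rewrite -comp2_assoc comp2_id -tf_comp1 mu_etar tf_one comp2_1r.
have dc : dom c = act Y ∘ map1 T f.
  by rewrite /c dom_comp2 dg dom_id /f tf_comp1 comp1_assoc.
have cc : cod c = f ∘ act X.
  by rewrite /c cod_comp2 cg cod_id fx -comp1_assoc mu_etal comp1_1r.
have ic : invertible c.
  by apply: invertible_comp2; [exact: um2_inv | exact: invertible_id].
have cu : c ⋆ \1 (eta T X) = \1 f.
  rewrite /c -comp2_assoc comp2_id.
  have /= <- := tn_nat1 (eta T) (eta T X).
  by rewrite -comp2_id comp2_assoc (um2_unit g) comp2_id.
(* Multiplicativity of [g] whiskered with [T T eta]. *)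
have cm : Cmp (c ⋆ \1 (map1 T (act X))) (\1 (act Y) ⋆ map2 T c) (c ⋆ \1 (mu T X)).
  have Nm := tn_nat1 (mu T) (eta T X); rewrite /= in Nm.
  rewrite cTx.
  have -> : c ⋆ \1 (mu T X) = um2 g ⋆ \1 (map1 T (eta T X)) ⋆ \1 (mu T X) by [].
  rewrite -comp2_assoc comp2_id -Nm -comp2_id comp2_assoc.
  have /= <- := um2_multE g; rewrite wr_vc; last by boundary.
  rewrite -!comp2_assoc !comp2_id -!tf_comp1 mu_etal tf_one comp2_1r.
  rewrite -fa_id -tf_comp2 -/c.
  by apply: Cmp_vc; rewrite cod_comp2 cod_fa cod_id cc fx.
exists (@MkTMap K T X Y f c dc cc ic cu cm).
by apply: TMap_eq => //; rewrite um2_comp_strictr.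
Qed.

Section Choice.
Variable U : forall (C C' : K) (phi : hom C C'), UnivPseudo T phi.

(** Over an identity 1-cell, the datum on [C'] is forced by the T-map, so [PC] classifies T-maps out
    of [TC]. *)
Lemma Pob_lift (C : K) (Y : TAlg T) (f : TMap (free T C) Y) :
  exists k : SMap (Pob U C) Y, TMap_comp (smap k) (up_map (U (one C))) = f.
Proof.
have [k [e _]] := up_lift (U (one C)) (esym (comp1_1r (um f ∘ eta T C))).
by exists k.
Qed.

Lemma Pob_ext (C : K) (Y : TAlg T) (j k : SMap (Pob U C) Y) :
  TMap_comp (smap j) (up_map (U (one C))) = TMap_comp (smap k) (up_map (U (one C))) -> j = k.
Proof.
move=> e; apply: up_ext => //.
have eu := f_equal (@um _ _ _ _) e; rewrite /= in eu.
have -> : up_kappa (U (one C)) = um (up_map (U (one C))) ∘ eta T C.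
  by rewrite up_sq comp1_1r.
by rewrite !comp1_assoc eu.
Qed.

Lemma strict_classifier (H4 : admits_coequalizers_of_Pfree_pairs U) (X : TAlg T) :
  exists (Z : TAlg T) (z : TMap X Z), forall (Y : TAlg T) (f : TMap X Y),
    exists! k : SMap Z Y, TMap_comp (smap k) z = f.
Proof.
have [Z [q [qe qU]]] := H4 X.
pose q' : SMap (Pob U X) Z := q.
have qe' : TMap_comp (smap q') (smap (Pmap U (mu_map T X))) =
           TMap_comp (smap q') (smap (Pmap U (free_map T (act X)))).
  by have := f_equal (@proj1_sig _ _) qe.
pose v := up_map (U (one (ca X))).
(* Descent applies because [v] intertwines the free pair with the P-free pair, which [q']
   coequalizes. *)
have [z zE] : exists z : TMap X Z, TMap_comp z (act_map X) = TMap_comp (smap q') v.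
  apply: act_map_descent.
  by rewrite -!TMap_compA !Pmap_square !TMap_compA qe'.
exists Z, z => Y f.
have [k0 k0E] := Pob_lift (TMap_comp f (act_map X)).
(* Restricted along the universal pseudomorphism, this says that [f ∘ act X] coequalizes [mu] and
   [T (act X)]. *)
have k0e : smap_comp k0 (Pmap U (mu_map T X)) = smap_comp k0 (Pmap U (free_map T (act X))).
  apply: Pob_ext.
  rewrite /= -!TMap_compA -!Pmap_square !TMap_compA k0E -!TMap_compA; f_equal.
  by apply: free_strict_ext; [exact: TMap_comp_strict | exact: TMap_comp_strict | rewrite /= act_mult].
have [k [kq kU]] := qU Y k0 k0e.
have kq' : TMap_comp (smap k) (smap q') = smap k0 by have := f_equal (@proj1_sig _ _) kq.
exists k; split.
  by apply: act_map_epi; rewrite -TMap_compA zE TMap_compA kq' k0E.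
move=> k' k'E; apply: kU; apply: Pob_ext; rewrite k0E -k'E.
by rewrite -[RHS]TMap_compA zE TMap_compA.
Qed.

End Choice.

Lemma whisker_comp (X Y Z W : TAlg T) (l : AlgCell Z W) (k : TMap Y Z) (z : TMap X Y) :
  AlgCell_comp2 (AlgCell_comp2 l (AlgCell_id k)) (AlgCell_id z) =
  AlgCell_comp2 l (AlgCell_id (TMap_comp k z)).
Proof.
apply: AlgCell_eq => /=; [exact: esym (TMap_compA _ _ _)..|].
by rewrite -comp2_assoc comp2_id.
Qed.

(** Through [M], the lift of {2,Y} to algebras, a 2-cell into [Y] is a T-map into [M], and a 2-cell
    between strict maps is a strict one. *)
Lemma strict_classifier_2dim (H2a : admits_cotensors K arrow_cat) (X Z : TAlg T)
    (z : TMap X Z) :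
  (forall (Y : TAlg T) (f : TMap X Y), exists! k : SMap Z Y, TMap_comp (smap k) z = f) ->
  forall (Y : TAlg T) (al : @arr (@hom (Alg T) X Y)),
    exists! be : arr (@hom (Algs T) Z Y),
      map2 (incl T) be ⋆ \1 (z : @hom (Alg T) X Z) = al.
Proof.
move=> zU Y al.
have [L [c]] := H2a Y; have [a0 [b0 [l0 Hl0]]] := cotensor_limit c.
have [M [a [b [l Hl]]]] := alg_limit_exists (f := TMap_one Y) Hl0.
have fact W (be : AlgCell W Y) : exists h : TMap W M,
    [/\ TMap_comp (smap a) h = adom be, TMap_comp (smap b) h = acod be &
        AlgCell_comp2 l (AlgCell_id h) = be].
  have [||h [ha hl]] := alim_ex Hl (a' := adom be) (l' := be) => //.
    by rewrite TMap_comp1l.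
  by exists h; split=> //; rewrite -{1}hl /= (alim_cod Hl).
have [h [ha hb hl]] := fact _ al.
have [k [kz _]] := zU _ h.
have s1 : is_strict (TMap_comp (adom l) (smap k)).
  rewrite (alim_dom Hl) TMap_comp1l; exact: TMap_comp_strict (proj2_sig a) (proj2_sig k).
have s2 : is_strict (TMap_comp (acod l) (smap k)).
  rewrite (alim_cod Hl); exact: TMap_comp_strict (proj2_sig b) (proj2_sig k).
exists (exist (fun c => is_strict (adom c) /\ is_strict (acod c))
  (AlgCell_comp2 l (AlgCell_id (smap k))) (conj s1 s2)); split.
  by rewrite /= -hl -kz; apply: whisker_comp.
move=> [be [d1 d2]] Ebe; apply: eq_sig_hprop => /=; first by move=> *; apply: proof_irrelevance.
have {}Ebe : AlgCell_comp2 be (AlgCell_id z) = al := Ebe.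
have [h' [ha' hb' hl']] := fact _ be.
(* A competing 2-cell has strict boundaries, so its classifying map is strict and uniqueness for [z]
   applies. *)
have sh' : is_strict h' by apply: (alim_strict Hl); rewrite ?ha' ?hb'.
pose k' : SMap Z M := exist (fun f => is_strict f) h' sh'.
have k'z : TMap_comp (smap k') z = h.
  apply: (alim_uniq Hl); first by rewrite TMap_compA ha' ha -Ebe.
  by rewrite -whisker_comp hl' Ebe hl.
have [k0 [_ kU]] := zU _ h.
have kk : k = k' by rewrite -(kU k) // -(kU k').
by rewrite kk.
Qed.

Lemma universal_classifier (H2a : admits_cotensors K arrow_cat)
  (H4 : forall U : (forall (C C' : K) (phi : hom C C'), UnivPseudo T phi),
     admits_coequalizers_of_Pfree_pairs U) :
  admits_universal_pseudomorphisms T -> admits_classifier T.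
Proof.
move=> HU.
(* With a trivial predicate, [epsilon] picks an element of each inhabited type; the choice fixes the
   P-free pairs. *)
pose U C C' (phi : hom C C') := epsilon (HU C C' phi) (fun _ => True).
have cl := strict_classifier (H4 U).
pose Q X := proj1_sig (constructive_indefinite_description _ (cl X)).
have cl' X : exists z : TMap X (Q X), forall (Y : TAlg T) (f : TMap X Y),
    exists! k : SMap (Q X) Y, TMap_comp (smap k) z = f.
  exact: proj2_sig (constructive_indefinite_description _ (cl X)).
pose z X := proj1_sig (constructive_indefinite_description _ (cl' X)).
have zU X := proj2_sig (constructive_indefinite_description _ (cl' X)).
have H := fun X => strict_classifier_2dim H2a (zU X).
split; exact: MkClassifier (@univ_adj (Alg T) (Algs T) (incl T) Q z H).
Qed.

End UniversalToClassifier.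

Theorem theorem1p9 (K : TwoCat) (T : TwoMonad K)
  (H1 : admits_pseudolimits_of_1cells K)
  (H2a : admits_cotensors K arrow_cat)
  (H2b : admits_cotensors K iso_cat)
  (H3 : admits_pushouts (Algs T))
  (H4 : forall U : (forall (C C' : K) (phi : hom C C'), UnivPseudo T phi),
     admits_coequalizers_of_Pfree_pairs U) :
  (admits_classifier T <-> admits_universal_pseudomorphisms T) /\
  (admits_classifier T ->
     (forall (Q : Classifier T) (Y : Alg T),
        exists Th : arr (@hom (Alg T) (Q Y) (Q Y)),
          is_adj_surj_equiv (zeta Q Y) (map1 (incl T) (delta Q Y)) Th) /\
     (forall (C C' : K) (phi : hom C C') (u : UnivPseudo T phi),
        @surjective_equivalence (Algs T) (free T C') (up_alg u) (Delta u))).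
Proof.
split; first split.
- exact: classifier_universal.
- exact: universal_classifier.
- move=> _; split.
  + exact: classifier_adj_surj_equiv.
  + exact: Delta_surjective_equivalence.
Qed.
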